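(* Let $A$ generate a uniformly bounded, strongly stable $C_0$-semigroup on a Hilbert space $H$. Fix $T>0$, put $\omega_n=2\pi n/T$, and suppose $i\omega_n\in\rho(A)$ for every $n\in\mathbb Z$ together with the sampled bound $$\|(i\omega_nI-A)^{-1}\|_{\mathcal L(H)}\le C(1+|\omega_n|)^m,\qquad n\in\mathbb Z,$$ for some $m\in\mathbb N$ and $C>0$. Then for every $f\in C^\infty_{\#}(0,T;H)$ the equation $\dot u=Au+f$ admits a unique classical $T$-periodic solution, and it lies in $C^\infty_{\#}(0,T;H)$. Consequently, a smooth statically resonant forcing necessitates infinite derivative loss: if $i\omega_n\in\rho(A)$ for all $n\in\mathbb Z$ and some $f\in C^\infty_{\#}(0,T;H)$ admits no $T$-periodic mild solution, then $A$ exhibits infinite derivative loss for the period $T$.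
   Context: Strongly stable means $S(t)x\to0$ as $t\to\infty$ for every $x\in H$, where $S(t)$ is the semigroup generated by $A$. The subscript $\#$ denotes spaces of $T$-periodic functions; $H^m_{\#}(0,T;H)$ is the periodic Sobolev space in time ($H^0_\#=L^2_\#$) and $C^\infty_{\#}(0,T;H)$ the smooth $T$-periodic $H$-valued functions. A mild solution of $\dot u=Au+f$ is $u(t)=S(t)u_0+\int_0^tS(t-s)f(s)\,ds$, $t\ge0$, $u_0\in H$. A forcing $f$ of period $T$ is statically resonant if there is no $T$-periodic mild solution. For integer $m\ge1$, $A$ exhibits $m$-derivative loss for the period $T$ if there does not exist $C_m>0$ with $\|u\|_{L^2(0,T;H)}\le C_m\|f\|_{H^{m-1}_{\#}(0,T;H)}$ for all $f\in H^{m-1}_{\#}(0,T;H)$ admitting a $T$-periodic mild solution $u$. Infinite derivative loss for $T$ means $m$-derivative loss for every $m\ge1$. *)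

(* Defs.v *)
From mathcomp Require Export all_boot all_order all_algebra.
From mathcomp Require Export complex.
From mathcomp Require Export all_classical all_reals all_analysis.

Set Implicit Arguments.
Unset Strict Implicit.
Unset Printing Implicit Defensive.

Import Order.TTheory GRing.Theory Num.Theory Num.Def.
Import numFieldNormedType.Exports.

Local Open Scope classical_set_scope.
Local Open Scope complex_scope.
Local Open Scope ring_scope.

(* In a normed module over R[i] the library norm `|x| is an element of R[i]
   with zero imaginary part; rnorm is the same number as an element of R. *)
Definition rnorm (R : realType) (V : normedModType R[i]) (x : V) : R :=
  complex.Re `|x|.

Definition is_inner_product (R : realType) (H : normedModType R[i])
    (dot : {dot H for @conjC R[i]}) : Prop :=
  forall x : H, `|x| ^+ 2 = dot x x.

Definition opnorm (R : realType) (H : normedModType R[i]) (L : H -> H) :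
    \bar R :=
  ereal_sup [set (rnorm (L x))%:E | x in [set x : H | rnorm x <= 1]].

(* Possibly unbounded operators: the values of op outside dom are irrelevant. *)
Record operator (H : Type) := Operator { dom : set H; op :> H -> H }.

Definition resolvent (R : realType) (H : normedModType R[i])
    (A : operator H) (lam : R[i]) (y : H) : H :=
  get [set x | dom A x /\ lam *: x - A x = y].

Definition resolvent_set (R : realType) (H : normedModType R[i])
    (A : operator H) : set R[i] :=
  [set lam | (forall y, exists! x, dom A x /\ lam *: x - A x = y) /\
             (opnorm (resolvent A lam) < +oo)%E].

(* Semigroups are functions on all of R of which only the values at t >= 0
   are used. *)
Record C0_semigroup (R : realType) (H : normedModType R[i])
    (S : R -> H -> H) : Prop := {
  semigroup_linear : forall t, 0 <= t -> linear (S t);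
  semigroup_continuous : forall t, 0 <= t -> continuous (S t);
  semigroup0 : forall x, S 0 x = x;
  semigroupD : forall s t x, 0 <= s -> 0 <= t -> S (s + t) x = S s (S t x);
  semigroup_cvg0 : forall x, S t x @[t --> 0^'+] --> x }.

Definition generates (R : realType) (H : normedModType R[i])
    (A : operator H) (S : R -> H -> H) : Prop :=
  dom A = [set x | cvg ((h^-1)%:C *: (S h x - x) @[h --> 0^'+])] /\
  forall x, dom A x -> (h^-1)%:C *: (S h x - x) @[h --> 0^'+] --> A x.

Definition uniformly_bounded (R : realType) (H : normedModType R[i])
    (S : R -> H -> H) : Prop :=
  exists M : R, forall t, 0 <= t -> (opnorm (S t) <= M%:E)%E.

Definition strongly_stable (R : realType) (H : normedModType R[i])
    (S : R -> H -> H) : Prop :=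
  forall x, S t x @[t --> +oo] --> (0 : H).

(* Derivatives in the real variable t of functions with values in a complex
   space; the derivative of the library would require a common scalar field. *)
Definition is_tderiv (R : realType) (V : normedModType R[i])
    (f : R -> V) (t : R) (l : V) : Prop :=
  (h^-1)%:C *: (f (t + h) - f t) @[h --> 0^'] --> l.

Definition smooth (R : realType) (V : normedModType R[i]) (f : R -> V) :
    Prop :=
  exists g : nat -> R -> V,
    g 0%N = f /\ forall k t, is_tderiv (g k) t (g k.+1 t).

Definition smooth_periodic (R : realType) (V : normedModType R[i]) (T : R)
    (f : R -> V) : Prop :=
  periodic f T /\ smooth f.

(* A simple function is given by a list of pairs (E, x), standing for the sum
   of the \1_E x. *)
Definition simple_fun (R : realType) (V : normedModType R[i])
    (s : seq (set R * V)) (t : R) : V :=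
  \sum_(p <- s) (\1_(p.1) t)%:C *: p.2.

Definition simple_measurable (R : realType) (V : normedModType R[i])
    (s : seq (set R * V)) : Prop :=
  forall p, p \in s -> measurable p.1.

Definition simple_integral (R : realType) (V : normedModType R[i])
    (a b : R) (s : seq (set R * V)) : V :=
  \sum_(p <- s) (fine (@lebesgue_measure R (`[a, b] `&` p.1)))%:C *: p.2.

Definition strongly_measurable (R : realType) (V : normedModType R[i])
    (a b : R) (f : R -> V) : Prop :=
  exists s : nat -> seq (set R * V),
    (forall n, simple_measurable (s n)) /\
    {ae @lebesgue_measure R, forall t, t \in `[a, b] ->
       simple_fun (s n) t @[n --> \oo] --> f t}.

(* f is Bochner integrable on [a, b], with Bochner integral v. *)
Definition is_bochner (R : realType) (V : normedModType R[i])
    (a b : R) (f : R -> V) (v : V) : Prop :=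
  strongly_measurable a b f /\
  exists s : nat -> seq (set R * V),
    [/\ forall n, simple_measurable (s n),
        (\int[@lebesgue_measure R]_(t in `[a, b])
           (rnorm (f t - simple_fun (s n) t))%:E)%E @[n --> \oo] --> 0%E
      & simple_integral a b (s n) @[n --> \oo] --> v].

Definition L2norm (R : realType) (V : normedModType R[i]) (T : R)
    (f : R -> V) : \bar R :=
  ((\int[@lebesgue_measure R]_(t in `[0%R, T]) (rnorm (f t) ^+ 2)%:E)
     `^ 2^-1)%E.

Definition L2_periodic (R : realType) (V : normedModType R[i]) (T : R)
    (f : R -> V) : Prop :=
  [/\ periodic f T, strongly_measurable 0 T f & (L2norm T f < +oo)%E].

Definition weak_deriv (R : realType) (V : normedModType R[i]) (T : R)
    (f g : R -> V) : Prop :=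
  forall phi dphi : R -> R[i]^o,
    smooth_periodic T phi -> (forall t, is_tderiv phi t (dphi t)) ->
    exists v : V, is_bochner 0 T (fun t => (dphi t : R[i]) *: f t) v /\
                  is_bochner 0 T (fun t => (phi t : R[i]) *: g t) (- v).

(* g 0 = f, ..., g k are the weak derivatives of f up to order k. *)
Definition weak_jet (R : realType) (V : normedModType R[i]) (T : R) (k : nat)
    (f : R -> V) (g : nat -> R -> V) : Prop :=
  [/\ g 0%N = f,
      forall j, (j <= k)%N -> L2_periodic T (g j)
    & forall j, (j < k)%N -> weak_deriv T (g j) (g j.+1)].

Definition sobolev_periodic (R : realType) (V : normedModType R[i]) (T : R)
    (k : nat) : set (R -> V) :=
  [set f | exists g, weak_jet T k f g].

(* Weak derivatives are unique up to null sets, so that on sobolev_periodic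
   the infimum is over a single value. *)
Definition sobolev_norm (R : realType) (V : normedModType R[i]) (T : R)
    (k : nat) (f : R -> V) : \bar R :=
  ereal_inf [set ((\sum_(j < k.+1) L2norm T (g j) `^ 2) `^ 2^-1)%E
            | g in [set g | weak_jet T k f g]].

Definition mild_solution (R : realType) (H : normedModType R[i])
    (S : R -> H -> H) (f u : R -> H) : Prop :=
  exists u0 : H, forall t, 0 <= t ->
    exists2 v, is_bochner 0 t (fun s => S (t - s) (f s)) v
             & u t = S t u0 + v.

Definition periodic_mild_solution (R : realType) (H : normedModType R[i])
    (S : R -> H -> H) (T : R) (f u : R -> H) : Prop :=
  periodic u T /\ mild_solution S f u.

Definition statically_resonant (R : realType) (H : normedModType R[i])
    (S : R -> H -> H) (T : R) (f : R -> H) : Prop :=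
  ~ exists u, periodic_mild_solution S T f u.

Definition periodic_classical_solution (R : realType)
    (H : normedModType R[i]) (A : operator H) (T : R) (f u : R -> H) : Prop :=
  periodic u T /\
  exists du : R -> H,
    [/\ continuous du,
        forall t, is_tderiv u t (du t)
      & forall t, dom A (u t) /\ du t = A (u t) + f t].

(* A enters only through the semigroup S it generates, which it determines. *)
Definition derivative_loss (R : realType) (H : normedModType R[i])
    (S : R -> H -> H) (T : R) (m : nat) : Prop :=
  ~ exists2 C : R, 0 < C &
      forall f u : R -> H, sobolev_periodic T m.-1 f ->
        periodic_mild_solution S T f u ->
        (L2norm T u <= C%:E * sobolev_norm T m.-1 f)%E.

Definition infinite_derivative_loss (R : realType) (H : normedModType R[i])
    (S : R -> H -> H) (T : R) : Prop :=
  forall m : nat, (1 <= m)%N -> derivative_loss S T m.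

Definition freq (R : realType) (T : R) (n : int) : R := 2 * pi * n%:~R / T.

Definition ifreq (R : realType) (T : R) (n : int) : R[i] := 0 +i* freq T n.

(* Main.v *)
Require Import Defs.
From mathcomp Require Import lra ring.

(** The forcing is a superposition of waves, f(t) = sum over n of e_n(t) c_n with
    e_n(t) = exp(i w_n t) and w_n = 2 pi n / T. A single wave e_n(t) x is
    answered by the periodic solution e_n(t) R_n x, where R_n is the resolvent
    of A at i w_n, so the candidate solution is u(t) = sum of e_n(t) R_n c_n.
    Integrating by parts, the coefficients c_n of a smooth forcing decay faster
    than every power of n ([fourier_decay]); they absorb the polynomial growth
    of R_n, and the series for u and all of its formal derivatives converge
    absolutely and may be differentiated term by term
    ([tderiv_wave_series]). The bounded resolvent makes A a closed operator
    ([generator_closed]), so A can be applied to the sum, and u' = A u + f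
    follows as soon as the Fourier series of f sums to f
    ([fourier_inversion]). For the latter, f - f(t0) is divided by the first
    wave shifted to vanish at t0: the partial sums then telescope to two
    Fourier coefficients of a continuous function, and these tend to zero by
    the Riemann-Lebesgue lemma.

    Uniqueness rests on Duhamel's formula ([duhamel]): a periodic solution of
    the homogeneous equation is an orbit of the semigroup that keeps coming
    back to its starting point, while strong stability sends it to zero
    ([periodic_homogeneous_eq0]).

    For the second claim, suppose that the estimate with loss of m derivatives
    held. Tested on the wave e_n(t) x, whose solution has L2 norm
    sqrt(T) |R_n x| and whose Sobolev norm of order m - 1 is at most a constant
    times (1 + |w_n|)^(m-1) |x|, it bounds the R_n polynomially
    ([sampled_bound_of_estimate]). By the first part every smooth forcing then
    has a classical periodic solution, which is a mild one by Duhamel's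
    formula, so no smooth forcing is statically resonant.

    Integrals of continuous vector-valued functions are limits of dyadic
    Riemann sums ([riemann_cvg]). The same sums are the integrals of step
    functions that approximate the integrand uniformly, which identifies these
    limits with Bochner integrals ([riemann_bochner]), both in the definition
    of mild solutions and in that of weak derivatives. *)

Set Implicit Arguments.
Unset Strict Implicit.
Unset Printing Implicit Defensive.

Import Order.TTheory GRing.Theory Num.Theory Num.Def.
Import numFieldNormedType.Exports.

Local Open Scope classical_set_scope.
Local Open Scope complex_scope.
Local Open Scope ring_scope.

(** * Real-valued norms *)

Section RealNorm.
Context {R : realType} {V : normedModType R[i]}.
Implicit Types (x y : V) (e r : R).

Lemma rnormE x : `|x| = (rnorm x)%:C.
Proof.
rewrite /rnorm; have := normr_ge0 x; case: `|x| => a b /=.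
by rewrite lecE /= => /andP[/eqP -> _].
Qed.

Lemma rnorm_ge0 x : 0 <= rnorm x.
Proof. by have := normr_ge0 x; rewrite rnormE lecE /= => /andP[]. Qed.

Lemma rnorm0 : rnorm (0 : V) = 0.
Proof. by rewrite /rnorm normr0. Qed.

Lemma rnorm0_eq0 x : rnorm x = 0 -> x = 0.
Proof. by move=> x0; apply/normr0_eq0; rewrite rnormE x0. Qed.

Lemma rnormN x : rnorm (- x) = rnorm x.
Proof. by rewrite /rnorm normrN. Qed.

Lemma rnorm_distC x y : rnorm (x - y) = rnorm (y - x).
Proof. by rewrite /rnorm distrC. Qed.

Lemma ler_rnormD x y : rnorm (x + y) <= rnorm x + rnorm y.
Proof.
have := ler_normD x y; rewrite !rnormE -rmorphD lecE /=.
by move=> /andP[].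
Qed.

Lemma ler_rnormB x y : rnorm (x - y) <= rnorm x + rnorm y.
Proof. by rewrite -[rnorm y]rnormN ler_rnormD. Qed.

Lemma ler_rnorm_sum (I : Type) (s : seq I) (P : pred I) (F : I -> V) :
  rnorm (\sum_(i <- s | P i) F i) <= \sum_(i <- s | P i) rnorm (F i).
Proof.
elim/big_ind2 : _ => [|x1 x2 y1 y2 h1 h2|//]; first by rewrite rnorm0.
exact: le_trans (ler_rnormD _ _) (lerD h1 h2).
Qed.

Lemma rnormZ (c : R[i]) x : rnorm (c *: x) = complex.Re `|c| * rnorm x.
Proof.
have : `|c *: x| = `|c| * `|x| by exact: normrZ.
rewrite !rnormE; have : `|c| = (complex.Re `|c|)%:C by case: (c).
move=> -> /=; rewrite -rmorphM /=; exact: (congr1 (@complex.Re R)).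
Qed.

Lemma rnormZr r x : rnorm (r%:C *: x) = `|r| * rnorm x.
Proof. by rewrite rnormZ /= expr0n addr0 sqrtr_sqr. Qed.

Lemma cvg_rnormP (T : Type) (F : set_system T) {FF : Filter F} (f : T -> V)
    (l : V) :
  f t @[t --> F] --> l <->
  forall e, 0 < e -> \forall t \near F, rnorm (f t - l) < e.
Proof.
split => [/cvgrPdist_lt fl e e0|fl].
  have ec : 0 < e%:C :> R[i] by rewrite ltcR.
  near=> t; have : `|l - f t| < e%:C by near: t; exact: fl.
  by rewrite rnormE ltcR rnorm_distC.
apply/cvgrPdist_lt => -[e e']; rewrite ltcE /= => /andP[/eqP -> e0].
have := fl _ e0; apply: filterS => t.
by rewrite rnorm_distC rnormE => h; rewrite ltcR.
Unshelve. all: by end_near. Qed.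

End RealNorm.

Lemma rnorm_scalar {R : realType} (c : R[i]) :
  @rnorm R (R[i]^o) c = complex.Re `|c|.
Proof. by []. Qed.

Lemma rnorm_lim_le {R : realType} {V : normedModType R[i]} (T : Type)
    (F : set_system T) {FF : ProperFilter F} (f : T -> V) (l : V) (K : R) :
  f t @[t --> F] --> l -> (\forall t \near F, rnorm (f t) <= K) ->
  rnorm l <= K.
Proof.
move=> /cvg_rnormP fl fK; apply/ler_addgt0Pr => e e0.
have [t [h1 h2]] := filter_ex (filterI (fl e e0) fK).
rewrite -[l](subrK (f t)) addrC.
by apply: le_trans (ler_rnormD _ _) _; rewrite lerD // rnorm_distC ltW.
Qed.

(** Only distances to one late term are tested, which is the form in which
    refinements of a partition and tails of a series are estimated below. *)
Lemma cauchy_rnorm {R : realType} {V : completeNormedModType R[i]}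
    (u : nat -> V) :
  (forall e : R, 0 < e -> exists N, forall n, (N <= n)%N ->
     rnorm (u n - u N) <= e) ->
  exists l : V, u n @[n --> \oo] --> l.
Proof.
move=> cu; suff /cvg_ex[l ul] : cvg (u n @[n --> \oo]) by exists l.
apply/cauchy_cvgP/cauchy_ballP => -[e e']; rewrite ltcE /= => /andP[/eqP -> e0].
have e40 : 0 < e / 4 by rewrite divr_gt0.
have [N hN] := cu _ e40.
have H n : (N <= n)%N -> rnorm (u n - u N) <= e / 4 by exact: hN.
exists ([set u n | n in [set n | (N <= n)%N]], [set u n | n in [set n | (N <= n)%N]]) => /=.
  by split; exists N => // n /= Nn; exists n.
move=> [x y] /= [[n Nn <-] [m Nm <-]].
rewrite -ball_normE /ball_ /= rnormE ltcR.
have -> : u n - u m = (u n - u N) - (u m - u N) by rewrite opprB addrA subrK.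
apply: le_lt_trans (ler_rnormB _ _) _; have := H _ Nn; have := H _ Nm; lra.
Qed.

(** * Uniform continuity on segments *)

Section UniformContinuity.
Context {R : realType} {V : normedModType R[i]} (a b : R) (g : R -> V).
Hypothesis gc : {within `[a, b], continuous g}.

Lemma within_itv_near t e : t \in `[a, b] -> 0 < e ->
  \forall s \near t, s \in `[a, b] -> rnorm (g s - g t) < e.
Proof.
move=> tab e0; have /subspace_continuousP/(_ t) := gc.
move=> /(_ tab)/cvg_rnormP/(_ e e0).
by rewrite near_withinE.
Qed.

(** Heine-Cantor: near every t one distance serves all nearby points, and
    compactness of the segment turns these into one distance for all t. *)
Lemma itv_uniform e : 0 < e -> exists2 d : R, 0 < d &
  forall s t, s \in `[a, b] -> t \in `[a, b] -> `|s - t| < d ->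
    rnorm (g s - g t) < e.
Proof.
move=> e0.
have cov := (@compact_near_coveringP _ _).1 (@segment_compact R a b)
  R (0 : R)^'+ (fun d t => forall s, s \in `[a, b] -> `|s - t| < d ->
  t \in `[a, b] -> rnorm (g s - g t) < e) _.
have h0 : \forall d \near (0 : R)^'+, forall t, t \in `[a, b] -> forall s,
    s \in `[a, b] -> `|s - t| < d -> t \in `[a, b] -> rnorm (g s - g t) < e.
  apply: cov => t /= tab.
  have e20 : 0 < e / 2 by rewrite divr_gt0.
  have /nbhs_ballP[d /= d0 hd] := within_itv_near tab e20.
  exists (ball t (d / 2), [set h | h < d / 2]) => /=.
    split; first by apply: nbhsx_ballx; rewrite divr_gt0.
    by apply: nbhs_right_lt; rewrite ?divr_gt0.
  move=> [r h] /= [tr hd2] s sab srh rab.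
  rewrite -(subrKA (g t)); apply: le_lt_trans (ler_rnormD _ _) _.
  rewrite [e in _ < e]splitr ltrD//.
    apply: hd => //; rewrite /ball /=.
    rewrite -(subrKA r); apply: le_lt_trans (ler_normD _ _) _.
    rewrite [d]splitr ltrD//.
    by rewrite distrC; apply: lt_trans srh hd2.
  rewrite rnorm_distC; apply: hd => //; rewrite /ball /=.
  by apply: lt_le_trans tr _; rewrite ler_pdivrMr// ler_peMr ?ltW// ltr1n.
have [d [hd d0]] := filter_ex (filterI h0 (nbhs_right_gt 0)).
by exists d => // s t sab tab st; exact: hd.
Qed.

Lemma itv_bounded : exists2 K : R, 0 <= K &
  forall t, t \in `[a, b] -> rnorm (g t) <= K.
Proof.
have [ab|ba] := leP a b; last first.
  by exists 0 => // t; rewrite in_itv /= => /andP[/le_trans h /h]; rewrite leNgt ba.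
have [] := @EVT_max R (fun t => rnorm (g t)) a b ab.
  apply/subspace_continuousP => t tab; apply/cvgrPdist_lt => e e0.
  have := within_itv_near tab e0; rewrite near_withinE; apply: filterS => s h sab.
  apply: le_lt_trans (h sab); rewrite rnorm_distC.
  rewrite ler_norml.
  have h1 := ler_rnormD (g t - g s) (g s); have h2 := ler_rnormD (g s - g t) (g t).
  rewrite !subrK in h1 h2; rewrite [rnorm (g s - _)]rnorm_distC in h2.
  by apply/andP; split; lra.
move=> c cab hc; exists (rnorm (g c)) => //; exact: rnorm_ge0.
Qed.

End UniformContinuity.

(** * Right derivatives *)

(** The generator differentiates orbits from the right only, so the fundamental
    theorem of calculus is developed for right derivatives. *)
Definition right_deriv {R : realType} {V : normedModType R[i]} (G : R -> V)
    (t : R) (l : V) : Prop :=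
  (h^-1)%:C *: (G (t + h) - G t) @[h --> 0^'+] --> l.

Lemma scale_real_continuous {R : realType} {V : normedModType R[i]} (c : R)
    (y : V) : continuous (fun s : R => (s - c)%:C *: y).
Proof.
move=> t; apply/cvg_rnormP => e e0.
have y1 : 0 < rnorm y + 1 by rewrite ltr_pwDr// rnorm_ge0.
apply/nbhs_ballP; exists (e / (rnorm y + 1)); first by rewrite /= divr_gt0.
move=> s; rewrite /ball /= distrC ltr_pdivlMr// => se.
rewrite -scalerBl -rmorphB /= rnormZr; apply: le_lt_trans se.
have -> : s - c - (t - c) = s - t by ring.
by rewrite ler_wpM2l// lerDl.
Qed.

Lemma within_sub_linear {R : realType} {V : normedModType R[i]} (A : set R)
    (G : R -> V) (c : R) (y : V) : {within A, continuous G} ->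
  {within A, continuous (fun s => G s - (s - c)%:C *: y)}.
Proof.
move=> Gc; apply: (@within_continuousB R _ V A G (fun s => (s - c)%:C *: y)) => //.
exact/continuous_subspaceT/scale_real_continuous.
Qed.

Section RightDerivative.
Context {R : realType} {V : normedModType R[i]}.
Implicit Types (G : R -> V) (t : R) (l : V).

(** Multiplying by the increment removes the quotient, after which all estimates
    are linear in the increment. *)
Lemma right_derivP G t l : right_deriv G t l <->
  forall e, 0 < e -> \forall h \near 0^'+,
    rnorm (G (t + h) - G t - h%:C *: l) <= e * h.
Proof.
have E h : 0 < h -> rnorm (G (t + h) - G t - h%:C *: l) =
    rnorm ((h^-1)%:C *: (G (t + h) - G t) - l) * h.
  move=> h0; rewrite mulrC -[X in X * _](ger0_norm (ltW h0)) -rnormZr scalerBr.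
  by rewrite scalerA -rmorphM /= divff ?gt_eqF// scale1r.
split=> [/cvg_rnormP h e e0|h].
  near=> r; have r0 : 0 < r by [].
  rewrite E// ler_pM2r// ltW//; near: r; exact: h.
apply/cvg_rnormP => e e0; have e20 : 0 < e / 2 by rewrite divr_gt0.
near=> r; have r0 : 0 < r by [].
suff : rnorm ((r^-1)%:C *: (G (t + r) - G t) - l) <= e / 2.
  move/le_lt_trans; apply; by rewrite ltr_pdivrMr// ltr_pMr// ltr1n.
by rewrite -(ler_pM2r r0) -E//; near: r; exact: h.
Unshelve. all: by end_near. Qed.

Lemma tderiv_right G t l : is_tderiv G t l -> right_deriv G t l.
Proof. by move/cvg_dnbhs_at_right. Qed.

Lemma right_deriv_sub_linear G t l c y : right_deriv G t l ->
  right_deriv (fun s => G s - (s - c)%:C *: y) t (l - y).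
Proof.
move=> /right_derivP h; apply/right_derivP => e /h; apply: filterS => r.
rewrite (_ : G (t + r) - _ - _ - _ = G (t + r) - G t - r%:C *: l)//.
have -> : (t + r - c)%:C *: y = (t - c)%:C *: y + r%:C *: y.
  by rewrite -scalerDl -rmorphD /=; congr (_%:C *: _); ring.
rewrite scalerBr !opprD !opprK !addrA.
(* opposite terms are brought together and cancel *)
by rewrite [LHS](ACl (1*4*6*(2*5)*(3*7)))/= !addNr !addr0.
Qed.

End RightDerivative.

(** * The mean value inequality *)

Section MeanValue.
Context {R : realType} {V : normedModType R[i]} (a b K : R) (G g : R -> V).
Hypotheses (ab : a <= b) (Gc : {within `[a, b], continuous G}).
Hypothesis Gg : forall s, a <= s < b -> right_deriv G s (g s).
Hypothesis gK : forall s, a <= s < b -> rnorm (g s) <= K.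

(** With a slack e in the slope, the s with |G s - G a| <= (K + e)(s - a) form a
    set with a largest element by continuity; the right derivative at that
    element would allow going further, unless it is b. *)
Lemma mean_value_right : rnorm (G b - G a) <= K * (b - a).
Proof.
have [->|neab] := eqVneq a b; first by rewrite !subrr rnorm0 mulr0.
have ltab : a < b by rewrite lt_neqAle neab.
have K0 : 0 <= K by apply: le_trans (rnorm_ge0 (g a)) (gK _); rewrite lexx.
suff H e : 0 < e -> rnorm (G b - G a) <= (K + e) * (b - a).
  apply/ler_addgt0Pr => e e0; have ba0 : 0 < b - a by rewrite subr_gt0.
  by have := H _ (divr_gt0 e0 ba0); rewrite mulrDl divfK// gt_eqF.
move=> e0; have Ke : 0 <= K + e by rewrite addr_ge0// ltW.
pose E := [set s | a <= s <= b /\ rnorm (G s - G a) <= (K + e) * (s - a)].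
have Ea : E a by split; rewrite ?lexx ?ab// !subrr rnorm0 mulr0.
have supE : has_sup E by split; [exists a|exists b => s [/andP[]]].
set c := sup E.
have ac : a <= c by exact: sup_upper_bound.
have cb : c <= b by apply: ge_sup; [exists a|move=> s [/andP[]]].
have Ec : rnorm (G c - G a) <= (K + e) * (c - a).
  apply/ler_addgt0Pr => r r0.
  have cab : c \in `[a, b] by rewrite in_itv /= ac.
  have /nbhs_ballP[d /= d0 hd] := within_itv_near Gc cab r0.
  have [s [sab sE] sc] := sup_adherent d0 supE.
  have sc' : s <= c by exact: sup_upper_bound.
  rewrite -(subrKA (G s)); apply: le_trans (ler_rnormD _ _) _.
  rewrite addrC lerD//.
    by apply: le_trans sE _; rewrite ler_wpM2l// lerB.
  rewrite rnorm_distC ltW//; apply: hd; last by rewrite in_itv.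
  by rewrite /ball /= ger0_norm ?subr_ge0// ltrBlDr -ltrBlDl.
suff cEb : c = b by rewrite -cEb.
apply/eqP; rewrite eq_le cb /= leNgt; apply/negP => ltcb.
have acb : a <= c < b by rewrite ac.
have /right_derivP/(_ e e0) near_c := Gg acb.
have bc0 : 0 < b - c by rewrite subr_gt0.
have [h [[h1 h2] h0]] := filter_ex (filterI (filterI near_c
  (nbhs_right_lt bc0)) (nbhs_right_gt 0)).
suff /(sup_upper_bound supE) : E (c + h).
  by rewrite /= -/c gerDl leNgt h0.
split; first by rewrite (le_trans ac) ?lerDl 1?ltW//= -ltrBrDl.
have -> : G (c + h) - G a = (G c - G a) + (h%:C *: g c)
    + (G (c + h) - G c - h%:C *: g c).
  by rewrite !addrA [RHS](ACl (4*2*(3*6)*(1*5)))/= !subrr !addr0.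
apply: le_trans (ler_rnormD _ _) _.
have -> : (K + e) * (c + h - a) = (K + e) * (c - a) + K * h + e * h by ring.
rewrite lerD//; apply: le_trans (ler_rnormD _ _) _; rewrite lerD//.
by rewrite rnormZr gtr0_norm// mulrC ler_wpM2r ?gK// ltW.
Qed.

End MeanValue.

(** * Riemann sums over dyadic partitions *)

Section RiemannSums.
Context {R : realType} {V : normedModType R[i]}.
Implicit Types (a b t e : R) (g : R -> V) (n p k : nat).

Definition mesh a b n : R := (b - a) / 2 ^+ n.

Definition node a b n k : R := a + k%:R * mesh a b n.

Definition riemann a b g n : V :=
  \sum_(0 <= k < (2 ^ n)%N) (mesh a b n)%:C *: g (node a b n k).

Lemma mesh_ge0 a b n : a <= b -> 0 <= mesh a b n.
Proof. by move=> ab; rewrite divr_ge0 ?subr_ge0// exprn_ge0. Qed.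

Lemma node0 a b n : node a b n 0 = a.
Proof. by rewrite /node mul0r addr0. Qed.

Lemma nodeS a b n k : node a b n k.+1 = node a b n k + mesh a b n.
Proof. by rewrite /node -natr1 mulrDl mul1r addrA. Qed.

Lemma node_last a b n : node a b n (2 ^ n)%N = b.
Proof. by rewrite /node natrX mulrC divfK ?subrKC// expf_neq0. Qed.

Lemma node_le a b n k j : a <= b -> (k <= j)%N -> node a b n k <= node a b n j.
Proof. by move=> ab kj; rewrite lerD2l ler_wpM2r ?mesh_ge0// ler_nat. Qed.

Lemma node_itv a b n k : a <= b -> (k <= 2 ^ n)%N -> node a b n k \in `[a, b].
Proof.
move=> ab k2; rewrite in_itv /=; apply/andP; split.
  by have := node_le n ab (leq0n k); rewrite node0.
by have := node_le n ab k2; rewrite node_last.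
Qed.

Lemma cell_sub a b n k t : a <= b -> (k < 2 ^ n)%N ->
  t \in `[node a b n k, node a b n k.+1] -> t \in `[a, b].
Proof.
move=> ab k2; rewrite in_itv /= => /andP[h1 h2].
have := node_itv ab k2; have := node_itv ab (ltnW k2).
rewrite !in_itv /= => /andP[h3 _] /andP[_ h4].
by rewrite (le_trans h3) ?(le_trans h2).
Qed.

Lemma mesh_cell a b n p k :
  mesh (node a b n k) (node a b n k.+1) p = mesh a b (n + p).
Proof. by rewrite /mesh nodeS addrAC subrr add0r /mesh exprD invfM mulrA. Qed.

(** The nodes of order n + p are the nodes of order p in each cell of order n. *)
Lemma riemannD a b g n p : riemann a b g (n + p) =
  \sum_(0 <= k < (2 ^ n)%N) riemann (node a b n k) (node a b n k.+1) g p.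
Proof.
rewrite /riemann expnD big_nat_mul; apply: eq_bigr => k _.
rewrite -{1}[(k * _)%N]add0n big_addn mulSn addnK.
apply: eq_bigr => j _; rewrite mesh_cell; congr (_ *: g _).
rewrite /node mesh_cell /mesh natrD natrM natrX exprD.
have h1 : 2 ^+ n != 0 :> R by rewrite expf_neq0.
have h2 : 2 ^+ p != 0 :> R by rewrite expf_neq0.
by field; rewrite h1 h2.
Qed.

Lemma mesh_total a b n : mesh a b n *+ 2 ^ n = b - a.
Proof. by rewrite -mulr_natr natrX /mesh divfK// expf_neq0. Qed.

Lemma sum_mesh a b n (y : V) :
  \sum_(0 <= k < (2 ^ n)%N) (mesh a b n)%:C *: y = (b - a)%:C *: y.
Proof.
by rewrite -scaler_suml sumr_const_nat subn0 -rmorphMn /= mesh_total.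
Qed.

(** With y the value of g at the left end of a short interval, this compares
    one cell of a Riemann sum with all of its refinements. *)
Lemma riemann_near a b g (y : V) e n : a <= b ->
  (forall t, t \in `[a, b] -> rnorm (g t - y) <= e) ->
  rnorm (riemann a b g n - (b - a)%:C *: y) <= (b - a) * e.
Proof.
move=> ab ge; rewrite -(sum_mesh a b n) -sumrB.
apply: le_trans (ler_rnorm_sum _ _ _) _.
have -> : (b - a) * e = \sum_(0 <= k < (2 ^ n)%N) mesh a b n * e.
  by rewrite sumr_const_nat subn0 -mulrnAl mesh_total.
rewrite big_nat [leRHS]big_nat; apply: ler_sum => k /andP[_ k2].
rewrite -scalerBr rnormZr ger0_norm ?mesh_ge0// ler_wpM2l ?mesh_ge0//.
by apply: ge; apply: node_itv; rewrite // ltnW.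
Qed.

Lemma mesh_cvg a b d : 0 < d -> exists N, forall n, (N <= n)%N -> mesh a b n < d.
Proof.
move=> d0; exists (Num.truncn ((b - a) / d)).+1 => n Nn.
rewrite ltr_pdivrMr ?exprn_gt0// mulrC -ltr_pdivrMr//.
apply: lt_le_trans (truncnS_gt _) _.
rewrite -natrX ler_nat; apply: leq_trans Nn _; exact: ltnW (ltn_expl _ _).
Qed.

Lemma mesh_oscillation a b g e : a <= b -> {within `[a, b], continuous g} ->
  0 < e -> exists N, forall n k t, (N <= n)%N -> (k < 2 ^ n)%N ->
    t \in `[node a b n k, node a b n k.+1] -> rnorm (g t - g (node a b n k)) <= e.
Proof.
move=> ab gc e0; have [d d0 hd] := itv_uniform gc e0.
have [N hN] := mesh_cvg a b d0; exists N => n k t Nn k2 tk.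
rewrite ltW// hd ?(cell_sub ab k2 tk) ?node_itv 1?ltnW//.
move: tk; rewrite in_itv /= nodeS => /andP[h1 h2].
by rewrite ger0_norm ?subr_ge0//; have := hN _ Nn; lra.
Qed.

End RiemannSums.

(** For a continuous integrand the dyadic sums are Cauchy, since refining a
    fine partition changes each cell by at most the oscillation there. *)
Lemma riemann_cvg {R : realType} {V : completeNormedModType R[i]} (a b : R)
    (g : R -> V) : a <= b -> {within `[a, b], continuous g} ->
  exists l : V, riemann a b g n @[n --> \oo] --> l.
Proof.
move=> ab gc; apply: cauchy_rnorm => e e0.
have ba : 0 < b - a + 1 by rewrite ltr_pwDr// subr_ge0.
have [N hN] := mesh_oscillation ab gc (divr_gt0 e0 ba).
exists N => n Nn; rewrite -(subnKC Nn) riemannD -sumrB.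
apply: le_trans (ler_rnorm_sum _ _ _) _.
apply: (@le_trans _ _ (\sum_(0 <= k < (2 ^ N)%N) mesh a b N * (e / (b - a + 1)))).
  rewrite big_nat [leRHS]big_nat; apply: ler_sum => k /andP[_ k2].
  have -> : mesh a b N = node a b N k.+1 - node a b N k.
    by rewrite nodeS addrAC subrr add0r.
  apply: riemann_near; first exact: node_le.
  by move=> t; exact: hN.
by rewrite sumr_const_nat subn0 -mulrnAl mesh_total mulrCA ger_pMr// ler_pdivrMr// mul1r lerDl.
Qed.

(** The mean value inequality on each cell, applied to G minus the linear
    function with the slope of the Riemann sum, bounds the error. *)
Lemma riemann_ftc {R : realType} {V : normedModType R[i]} (a b : R)
    (G g : R -> V) : a <= b ->
  {within `[a, b], continuous G} -> {within `[a, b], continuous g} ->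
  (forall s, a <= s < b -> right_deriv G s (g s)) ->
  riemann a b g n @[n --> \oo] --> G b - G a.
Proof.
move=> ab Gc gc Gg; apply/cvg_rnormP => e e0.
have ba : 0 < b - a + 1 by rewrite ltr_pwDr// subr_ge0.
have [N hN] := mesh_oscillation ab gc (divr_gt0 e0 ba).
exists N => // n /= Nn.
have -> : G b - G a =
    \sum_(0 <= k < (2 ^ n)%N) (G (node a b n k.+1) - G (node a b n k)).
  by rewrite (telescope_sumr (fun k => G (node a b n k)))// node_last node0.
rewrite -sumrB; apply: le_lt_trans (ler_rnorm_sum _ _ _) _.
apply: (@le_lt_trans _ _ (\sum_(0 <= k < (2 ^ n)%N) (e / (b - a + 1)) * mesh a b n)).
  rewrite big_nat [leRHS]big_nat; apply: ler_sum => k /andP[_ k2].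
  set x := node a b n k; set y := node a b n k.+1.
  have yx : mesh a b n = y - x by rewrite /y nodeS addrAC subrr add0r.
  have xy : x <= y by exact: node_le.
  rewrite rnorm_distC yx.
  have -> : G y - G x - (y - x)%:C *: g x =
      (G y - (y - x)%:C *: g x) - (G x - (x - x)%:C *: g x).
    by rewrite subrr scale0r subr0 addrAC.
  apply: (@mean_value_right R V x y _ (fun s => G s - (s - x)%:C *: g x)
    (fun s => g s - g x)) => //.
  - apply: within_sub_linear; apply: continuous_subspaceW Gc => s /=.
    exact: cell_sub.
  - move=> s /andP[xs sy]; apply: right_deriv_sub_linear; apply: Gg.
    have := node_itv ab (ltnW k2); have := node_itv ab k2; rewrite !in_itv /=.
    by move=> /andP[_ h1] /andP[h2 _]; rewrite (le_trans h2)// (lt_le_trans sy).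
  move=> s /andP[xs /ltW sy]; apply: hN => //; by rewrite in_itv /= xs.
rewrite sumr_const_nat subn0 -mulrnAr mesh_total mulrAC -mulrA gtr_pMr//.
by rewrite ltr_pdivrMr// mul1r ltrDl.
Qed.

(** * Two-sided derivatives *)

Section TimeDerivative.
Context {R : realType} {V : normedModType R[i]}.
Implicit Types (f g : R -> V) (t : R) (l : V).

Lemma tderivP f t l : is_tderiv f t l <->
  forall e, 0 < e -> \forall h \near (0 : R),
    rnorm (f (t + h) - f t - h%:C *: l) <= e * `|h|.
Proof.
have E h : h != 0 -> rnorm (f (t + h) - f t - h%:C *: l) =
    rnorm ((h^-1)%:C *: (f (t + h) - f t) - l) * `|h|.
  move=> h0; rewrite mulrC -rnormZr scalerBr scalerA -rmorphM /=.
  by rewrite divff// scale1r.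
split=> [/cvg_rnormP h e e0|h].
  have := h e e0; rewrite near_withinE; apply: filterS => r hr.
  have [->|r0] := eqVneq r 0.
    by rewrite addr0 subrr scale0r subr0 rnorm0 normr0 mulr0.
  by rewrite E// ler_pM2r ?normr_gt0// ltW// hr.
apply/cvg_rnormP => e e0; have e20 : 0 < e / 2 by rewrite divr_gt0.
rewrite near_withinE; have := h _ e20; apply: filterS => r hr r0.
apply: (@le_lt_trans _ _ (e / 2)); last first.
  by rewrite ltr_pdivrMr// ltr_pMr// ltr1n.
by rewrite -(@ler_pM2r _ `|r|) ?normr_gt0// -E.
Qed.

Lemma tderiv_shift_cvg f t l : is_tderiv f t l -> f (t + h) @[h --> 0] --> f t.
Proof.
move=> /tderivP h; apply/cvg_rnormP => e e0.
have l1 : 0 < 1 + rnorm l by rewrite ltr_pwDl// rnorm_ge0.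
have h1 := h 1 ltr01; have [d /= d0 hd] := (nbhs_ballP _ _).1 h1.
apply/nbhs_ballP; exists (Num.min d (e / (1 + rnorm l))) => /=.
  by rewrite lt_min d0 divr_gt0.
move=> r; rewrite /ball /= sub0r normrN lt_min => /andP[rd re].
have := hd r; rewrite /ball /= sub0r normrN => /(_ rd) hr.
rewrite -[f (t + r) - f t](subrK (r%:C *: l)).
apply: le_lt_trans (ler_rnormD _ _) _.
apply: le_lt_trans (lerD hr (lexx _)) _.
by rewrite rnormZr mul1r -[X in X + _]mulr1 -mulrDr -ltr_pdivlMr.
Qed.

Lemma tderiv_continuous f t l : is_tderiv f t l -> {for t, continuous f}.
Proof.
move=> /tderiv_shift_cvg/cvg_rnormP h; apply/cvg_rnormP => e /h.
move=> /nbhs_ballP[d /= d0 hd]; apply/nbhs_ballP; exists d => //= s.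
rewrite /ball /= => ts; have := hd (s - t).
by rewrite /ball /= sub0r opprB subrKC; exact.
Qed.

Lemma tderiv_unique f t l1 l2 : is_tderiv f t l1 -> is_tderiv f t l2 -> l1 = l2.
Proof. by move=> h1 h2; apply: (cvg_unique _ h1 h2). Qed.

Lemma tderivB f g t l1 l2 : is_tderiv f t l1 -> is_tderiv g t l2 ->
  is_tderiv (fun s => f s - g s) t (l1 - l2).
Proof.
move=> h1 h2; rewrite /is_tderiv.
have -> : (fun h : R => (h^-1)%:C *: (f (t + h) - g (t + h) - (f t - g t))) =
    (fun h : R => (h^-1)%:C *: (f (t + h) - f t)
                - (h^-1)%:C *: (g (t + h) - g t)).
  by apply/funext => h; rewrite -scalerBr !opprB !addrA; congr (_ *: _);
    rewrite [RHS](ACl (1*4*3*2))/=; congr (_ + _); rewrite addrAC.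
exact: cvgB h1 h2.
Qed.

Lemma tderiv_cst (x : V) t : is_tderiv (fun=> x) t 0.
Proof.
rewrite /is_tderiv; under eq_fun do rewrite subrr scaler0.
exact: cvg_cst.
Qed.

Lemma mean_value f g K a b : a <= b -> (forall t, is_tderiv f t (g t)) ->
  (forall t, a <= t < b -> rnorm (g t) <= K) ->
  rnorm (f b - f a) <= K * (b - a).
Proof.
move=> ab fg gK; apply: (@mean_value_right _ _ a b K f g) => //.
  by apply: continuous_subspaceT => t; exact: tderiv_continuous (fg t).
by move=> s _; exact: tderiv_right.
Qed.

End TimeDerivative.

(** The product rule for a scalar and a vector factor; scalars live in [R[i]^o],
    the complex field as a normed space over itself. *)
Lemma tderiv_scale {R : realType} {V : normedModType R[i]} (phi : R -> R[i]^o)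
    (f : R -> V) (t : R) (dphi : R[i]^o) (l : V) :
  is_tderiv phi t dphi -> is_tderiv f t l ->
  is_tderiv (fun s => (phi s : R[i]) *: f s) t
    ((dphi : R[i]) *: f t + (phi t : R[i]) *: l).
Proof.
move=> h1 h2; rewrite /is_tderiv.
have -> : (fun h : R => (h^-1)%:C *: ((phi (t + h) : R[i]) *: f (t + h)
    - (phi t : R[i]) *: f t)) =
    (fun h : R => ((h^-1)%:C *: (phi (t + h) - phi t) : R[i]) *: f (t + h)
    + (phi t : R[i]) *: ((h^-1)%:C *: (f (t + h) - f t))).
  apply/funext => h; set c := (h^-1)%:C; set p := phi (t + h); set q := phi t.
  have -> : (c *: (p - q) : R[i]) = c * (p - q) by [].
  rewrite -scalerA (scalerA (q : R[i]) c) [(q : R[i]) * c]mulrC -(scalerA c).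
  by rewrite -scalerDr scalerBl (scalerBr (q : R[i])) addrA subrK.
apply: cvgD.
  apply: cvgZ; first exact: h1.
  by apply: cvg_within_filter; exact: tderiv_shift_cvg h2.
by apply: cvgZ; [exact: cvg_cst|exact: h2].
Qed.

Lemma tderiv_scale_cst {R : realType} {V : normedModType R[i]}
    (phi : R -> R[i]^o) (t : R) (dphi : R[i]^o) (x : V) :
  is_tderiv phi t dphi ->
  is_tderiv (fun s => (phi s : R[i]) *: x) t ((dphi : R[i]) *: x).
Proof.
move=> h; have := tderiv_scale h (tderiv_cst x t).
by rewrite scaler0 addr0.
Qed.

(** * The integral of a continuous function *)

Lemma cvg_sum_nat {R : realType} {V : normedModType R[i]} (u : nat -> nat -> V)
    (l : nat -> V) N : (forall k, (k < N)%N -> u k n @[n --> \oo] --> l k) ->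
  \sum_(0 <= k < N) u k n @[n --> \oo] --> \sum_(0 <= k < N) l k.
Proof.
elim: N => [|N IHN] ul.
  by under eq_fun do rewrite big_nil; rewrite big_nil; exact: cvg_cst.
under eq_fun do rewrite big_nat_recr//=; rewrite big_nat_recr//=.
by apply: cvgD; [apply: IHN => k kN; exact/ul/leqW|exact: ul].
Qed.

Section RiemannIntegral.
Context {R : realType} {V : completeNormedModType R[i]}.
Implicit Types (a b e K : R) (f g : R -> V) (y l : V).

Definition Rint a b g : V := lim (riemann a b g n @[n --> \oo]).

Lemma Rint_unique a b g l : riemann a b g n @[n --> \oo] --> l -> Rint a b g = l.
Proof. exact: cvg_lim. Qed.

Lemma Rint_cvg a b g : a <= b -> {within `[a, b], continuous g} ->
  riemann a b g n @[n --> \oo] --> Rint a b g.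
Proof. by move=> ab gc; have [l gl] := riemann_cvg ab gc; rewrite (Rint_unique gl). Qed.

Lemma Rint_ftc a b f g : a <= b -> (forall t, is_tderiv f t (g t)) ->
  {within `[a, b], continuous g} -> Rint a b g = f b - f a.
Proof.
move=> ab fg gc; apply/Rint_unique/riemann_ftc => //.
  by apply: continuous_subspaceT => t; exact: tderiv_continuous (fg t).
by move=> s _; exact: tderiv_right.
Qed.

Lemma RintD a b f g : a <= b -> {within `[a, b], continuous f} ->
  {within `[a, b], continuous g} ->
  Rint a b (fun t => f t + g t) = Rint a b f + Rint a b g.
Proof.
move=> ab fc gc; apply: Rint_unique.
have -> : riemann a b (fun t => f t + g t) =
    (fun n => riemann a b f n + riemann a b g n).
  apply/funext => n; rewrite -big_split /=; apply: eq_bigr => k _.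
  by rewrite scalerDr.
by apply: cvgD; exact: Rint_cvg.
Qed.

Lemma RintZ a b (c : R[i]) f : a <= b -> {within `[a, b], continuous f} ->
  Rint a b (fun t => c *: f t) = c *: Rint a b f.
Proof.
move=> ab fc; apply: Rint_unique.
have -> : riemann a b (fun t => c *: f t) = (fun n => c *: riemann a b f n).
  apply/funext => n; rewrite scaler_sumr; apply: eq_bigr => k _.
  by rewrite !scalerA mulrC.
by apply: cvgZ; [exact: cvg_cst|exact: Rint_cvg].
Qed.

Lemma Rint_near a b g y e : a <= b -> {within `[a, b], continuous g} ->
  (forall t, t \in `[a, b] -> rnorm (g t - y) <= e) ->
  rnorm (Rint a b g - (b - a)%:C *: y) <= (b - a) * e.
Proof.
move=> ab gc gy; apply: (@rnorm_lim_le _ _ nat \oo _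
  (fun n => riemann a b g n - (b - a)%:C *: y)).
  by apply: cvgB; [exact: Rint_cvg|exact: cvg_cst].
by near=> n; exact: riemann_near.
Unshelve. all: by end_near. Qed.

Lemma rnorm_Rint a b g K : a <= b -> {within `[a, b], continuous g} ->
  (forall t, t \in `[a, b] -> rnorm (g t) <= K) ->
  rnorm (Rint a b g) <= (b - a) * K.
Proof.
move=> ab gc gK; have := @Rint_near a b g 0 K ab gc.
by rewrite scaler0 subr0; apply => t tab; rewrite subr0 gK.
Qed.

(** Additivity over the cells of a dyadic partition is exact already for the
    Riemann sums, by [riemannD]. *)
Lemma Rint_split a b g n : a <= b -> {within `[a, b], continuous g} ->
  Rint a b g = \sum_(0 <= k < (2 ^ n)%N) Rint (node a b n k) (node a b n k.+1) g.
Proof.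
move=> ab gc; apply: Rint_unique.
rewrite -(cvg_shiftn n) /=.
have -> : (fun m => riemann a b g (m + n)) = (fun m =>
    \sum_(0 <= k < (2 ^ n)%N) riemann (node a b n k) (node a b n k.+1) g m).
  by apply/funext => m; rewrite addnC riemannD.
apply: cvg_sum_nat => k k2; apply: Rint_cvg; first exact: node_le.
by apply: continuous_subspaceW gc => t /=; exact: cell_sub.
Qed.

End RiemannIntegral.

(** * Bochner integrability of continuous functions *)

Section Bochner.
Context {R : realType}.

(** The integral of a nonnegative function is the supremum of the integrals of
    the simple functions below it, and this supremum is monotone. In this form
    the error of a step function can be bounded by a constant directly. *)
Lemma ge0_le_integral_simple (D : set R) (f1 f2 : R -> \bar R) :
  (forall x, D x -> (0 <= f1 x)%E) -> (forall x, D x -> (f1 x <= f2 x)%E) ->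
  (\int[@lebesgue_measure R]_(x in D) f1 x <=
   \int[@lebesgue_measure R]_(x in D) f2 x)%E.
Proof.
move=> f0 f12; rewrite !ge0_integralE//; last first.
  by move=> x Dx; exact: le_trans (f0 _ Dx) (f12 _ Dx).
apply: ereal_sup_le => _ /= [h hf <-]; exists h => // x.
apply: le_trans (hf x) _; rewrite /patch; case: ifP => // /set_mem.
exact: f12.
Qed.

Context {V : normedModType R[i]}.
Implicit Types (a b t e : R) (g : R -> V) (n k : nat).

(** The cells are closed on the left, which leaves out the point b; it gets a
    piece of its own so that the approximation is uniform on all of [a, b]. *)
Definition step_approx a b g n : seq (set R * V) :=
  ([set b], g b) ::
  [seq (`[node a b n k, node a b n k.+1[%classic, g (node a b n k))
     | k <- index_iota 0 (2 ^ n)].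

Lemma step_approx_measurable a b g n : simple_measurable (step_approx a b g n).
Proof.
move=> p; rewrite inE => /orP[/eqP ->|/mapP[k _ ->]] /=.
  exact: measurable_set1.
exact: measurable_itv.
Qed.

Lemma simple_integral_step a b g n : a <= b ->
  simple_integral a b (step_approx a b g n) = riemann a b g n.
Proof.
move=> ab; rewrite /simple_integral big_cons /= big_map.
have -> : `[a, b] `&` [set b] = [set b].
  by apply/seteqP; split=> [t []//|t /= ->]; rewrite in_itv /= ab lexx.
rewrite lebesgue_measure_set1 /= scale0r add0r.
rewrite big_nat [RHS]big_nat; apply: eq_bigr => k /andP[_ k2].
congr (_%:C *: _).
have -> : `[a, b] `&` `[node a b n k, node a b n k.+1[ =
    `[node a b n k, node a b n k.+1[%classic.
  apply/seteqP; split=> [t []//|t /= h]; split=> //; apply: (cell_sub ab k2).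
  by move: h; rewrite !in_itv /= => /andP[-> /ltW].
rewrite lebesgue_measure_itv /= lte_fin nodeS ltrDl; case: ltP => [_|h].
  by rewrite /= addrAC subrr add0r.
by apply/eqP; rewrite eq_le h mesh_ge0.
Qed.

Lemma locate_node (x : nat -> R) t n : x 0%N <= t < x n ->
  exists2 k, (k < n)%N & x k <= t < x k.+1.
Proof.
elim: n => [|n IHn] /andP[x0 xn]; first by move: x0; rewrite leNgt xn.
have [tn|nt] := ltP t (x n); last by exists n => //; rewrite nt.
by have [|k kn h] := IHn; [rewrite x0|exists k => //; exact: ltnW].
Qed.

Lemma simple_fun_step a b g n t : t \in `[a, b] ->
  simple_fun (step_approx a b g n) t = g t \/
  exists k, [/\ (k < 2 ^ n)%N, t \in `[node a b n k, node a b n k.+1] &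
    simple_fun (step_approx a b g n) t = g (node a b n k)].
Proof.
rewrite in_itv /= => /andP[ta tb]; have ab := le_trans ta tb.
rewrite /simple_fun big_cons big_map /=.
have [tEb|tneb] := eqVneq t b.
  left; rewrite tEb indicE mem_set// scale1r big_nat big1 ?addr0// => k /andP[_ k2].
  rewrite indicE memNset ?scale0r//= in_itv /= => /andP[_].
  rewrite ltNge => /negP; apply.
  by have := node_itv ab k2; rewrite in_itv /= => /andP[].
right; have ltb : t < b by rewrite lt_neqAle tneb.
have [|k k2 /andP[h1 h2]] := @locate_node (node a b n) t (2 ^ n).
  by rewrite node0 node_last ta.
exists k; split => //; first by rewrite in_itv /= h1 ltW.
rewrite indicE memNset ?scale0r ?add0r; last by move=> /= tEb; move: tneb; rewrite tEb eqxx.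
rewrite (bigD1_seq k) ?iota_uniq ?mem_index_iota//=.
rewrite indicE mem_set /= ?in_itv /= ?h1// scale1r big1 ?addr0// => j jk.
rewrite indicE memNset ?scale0r//= in_itv /= => /andP[h3 h4].
have [jk'|kj|/eqP] := ltngtP j k; last by rewrite (negbTE jk).
  by have := node_le n ab jk'; rewrite leNgt (le_lt_trans h1 h4).
by have := node_le n ab kj; rewrite leNgt (le_lt_trans h3 h2).
Qed.

Lemma step_approx_near a b g e : {within `[a, b], continuous g} -> 0 < e ->
  exists N, forall n t, (N <= n)%N -> t \in `[a, b] ->
    rnorm (g t - simple_fun (step_approx a b g n) t) <= e.
Proof.
move=> gc e0; have [ab|ba] := leP a b; last first.
  by exists 0%N => n t _; rewrite in_itv /= => /andP[/le_trans h /h]; rewrite leNgt ba.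
have [N hN] := mesh_oscillation ab gc e0; exists N => n t Nn tab.
have [->|[k [k2 tk ->]]] := simple_fun_step g n tab.
  by rewrite subrr rnorm0 ltW.
exact: hN.
Qed.

Lemma continuous_strongly_measurable a b g :
  {within `[a, b], continuous g} -> strongly_measurable a b g.
Proof.
move=> gc; exists (step_approx a b g); split=> [n|].
  exact: step_approx_measurable.
apply: aeW => t tab; apply/cvg_rnormP => e e0.
have e20 : 0 < e / 2 by rewrite divr_gt0.
have [N hN] := step_approx_near gc e20.
exists N => // n /= Nn; rewrite rnorm_distC.
by apply: le_lt_trans (hN _ _ Nn tab) _; rewrite ltr_pdivrMr// ltr_pMr// ltr1n.
Qed.

(** The step functions converge uniformly, hence in L1, and their integrals are
    the Riemann sums. *)
Lemma riemann_bochner a b g (v : V) : a <= b ->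
  {within `[a, b], continuous g} -> riemann a b g n @[n --> \oo] --> v ->
  is_bochner a b g v.
Proof.
move=> ab gc gv; split; first exact: continuous_strongly_measurable.
exists (step_approx a b g); split=> [n||].
- exact: step_approx_measurable.
- set I := fun n : nat => _; have I0 n : (0 <= I n)%E.
    by apply: integral_ge0 => t _; rewrite lee_fin rnorm_ge0.
  have II e : 0 < e -> \forall n \near \oo, (I n <= (e * (b - a))%:E)%E.
    move=> e0; have [N hN] := step_approx_near gc e0; exists N => // n /= Nn.
    apply: (@le_trans _ _ (\int[lebesgue_measure]_(t in `[a, b]) cst e%:E t)%E).
      by apply: ge0_le_integral_simple => t tab; rewrite lee_fin ?rnorm_ge0 ?hN.
    rewrite integral_cst//= lebesgue_measure_itv /= lte_fin.
    case: ltP => _; first by rewrite -EFinB -EFinM.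
    by rewrite mule0 lee_fin mulr_ge0 ?subr_ge0// ltW.
  have If n e : (I n <= e%:E)%E -> I n \is a fin_num.
    by move=> h; rewrite ge0_fin_numE// (le_lt_trans h)// ltry.
  apply/fine_cvgP; split.
    by have := II 1 ltr01; apply: filterS => n; exact: If.
  apply/cvgrPdist_le => e e0; have ba : 0 < b - a + 1 by rewrite ltr_pwDr// subr_ge0.
  have := II _ (divr_gt0 e0 ba); apply: filterS => n h.
  rewrite sub0r normrN /= ger0_norm ?fine_ge0// -lee_fin fineK ?(If _ _ h)//.
  apply: le_trans h _; rewrite lee_fin mulrAC ler_pdivrMr//.
  by rewrite ler_wpM2l ?lerDl// ltW.
- by under eq_fun do rewrite simple_integral_step//.
Qed.

End Bochner.

(** * Complex exponentials *)

Section Exponential.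
Context {R : realType}.
Implicit Types (t w x y : R) (n : int).

Lemma is_derive_cvg (p : R -> R) t (dp : R) : is_derive t (1 : R) p dp ->
  h^-1 * (p (t + h) - p t) @[h --> 0^'] --> dp.
Proof.
move=> [d <-]; move: d => /cvg_ex[l hl]; rewrite /derive (cvg_lim _ hl)//.
have -> // : (fun h : R => h^-1 * (p (t + h) - p t)) =
  (fun h : R => h^-1 *: ((p \o shift t) (h *: (1 : R)) - p t)).
by apply/funext => h /=; have -> : h *: (1 : R) = h by [exact: mulr1]; rewrite [h + t]addrC.
Qed.

Lemma rnorm_complex x y : @rnorm R (R[i]^o) (x +i* y) <= `|x| + `|y|.
Proof.
have -> : (x +i* y : R[i]^o) = x%:C + y%:C * 'i by simpc.
apply: le_trans (ler_rnormD _ _) _.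
rewrite rnorm_scalar /= expr0n addr0 sqrtr_sqr lerD2l.
by rewrite rnorm_scalar /=; simpc; rewrite expr0n /= add0r sqrtr_sqr.
Qed.

Lemma tderiv_complex (p q : R -> R) t (dp dq : R) :
  is_derive t (1 : R) p dp -> is_derive t (1 : R) q dq ->
  is_tderiv (fun s => p s +i* q s : R[i]^o) t (dp +i* dq).
Proof.
move=> /is_derive_cvg/cvgrPdist_lt hp /is_derive_cvg/cvgrPdist_lt hq.
apply/cvg_rnormP => e e0; have e20 : 0 < e / 2 by rewrite divr_gt0.
near=> h.
have h1 : `|dp - h^-1 * (p (t + h) - p t)| < e / 2 by near: h; exact: hp.
have h2 : `|dq - h^-1 * (q (t + h) - q t)| < e / 2 by near: h; exact: hq.
have -> : ((h^-1)%:C *: ((p (t + h) +i* q (t + h)) - (p t +i* q t)) : R[i]^o)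
     - (dp +i* dq) = (h^-1 * (p (t + h) - p t) - dp) +i*
     (h^-1 * (q (t + h) - q t) - dq).
  rewrite (_ : forall c z : R[i], (c *: (z : R[i]^o) : R[i]) = c * z)//.
  by rewrite /real_complex_def; simpc.
apply: le_lt_trans (rnorm_complex _ _) _.
by rewrite [e]splitr ltrD// distrC.
Unshelve. all: by end_near. Qed.

Definition expi x : R[i]^o := cos x +i* sin x.

Lemma expi0 : expi 0 = 1.
Proof. by rewrite /expi cos0 sin0. Qed.

Lemma expiD x y : expi (x + y) = (expi x : R[i]) * expi y.
Proof. by rewrite /expi cosD sinD; simpc; rewrite [X in _ +i* X]addrC [sin x * _]mulrC mulrC. Qed.

Lemma rnorm_expi x : rnorm (expi x) = 1.
Proof. by rewrite rnorm_scalar /= cos2Dsin2 sqrtr1. Qed.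

Lemma tderiv_expi w t : is_tderiv (fun s => expi (w * s)) t
  ((0 +i* w) * (expi (w * t) : R[i])).
Proof.
have -> : (0 +i* w) * (expi (w * t) : R[i]) =
    (- sin (w * t) * w) +i* (cos (w * t) * w).
  by rewrite /expi; simpc; rewrite mulrC [X in _ +i* X]mulrC.
by apply: tderiv_complex; apply: is_derive_eq; rewrite [w%:A]mulr1.
Qed.

Lemma expi2pi n : expi (2 * pi * n%:~R) = 1.
Proof.
have H k : expi (2 * pi * k%:R) = 1.
  elim: k => [|k IHk]; first by rewrite mulr0 expi0.
  rewrite -[k.+1%:R]natr1 mulrDr expiD IHk mul1r mulr1 /expi mulr_natl cos2pi.
  by rewrite mulr2n sinDpi sinpi oppr0.
case: n => k; first exact: H.
have := expiD (- (2 * pi * k.+1%:R)) (2 * pi * k.+1%:R).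
by rewrite addNr expi0 H mulr1 NegzE mulrNz mulrN => <-.
Qed.

(** By cos x = 1 - 2 sin^2 (x/2), the real part is 1 only if sin (x/2) = 0. *)
Lemma expi_neq1 x : 0 < x < pi *+ 2 -> expi x != 1.
Proof.
move=> /andP[x0 x2]; apply/eqP => /(congr1 (@complex.Re R)) /=.
have -> : x = (x / 2) *+ 2 by rewrite -mulr_natr divfK.
rewrite cos_mulr2n => h.
have : 0 < sin (x / 2).
  by rewrite sin_gt0_pi// divr_gt0//= ltr_pdivrMr// mulr_natr.
have : sin (x / 2) ^+ 2 = 0.
  rewrite sin2cos2; move: h; set c := _ ^+ 2; rewrite mulr2n => h; lra.
by move=> /eqP; rewrite sqrf_eq0 => /eqP ->; rewrite ltxx.
Qed.

End Exponential.

Section Frequencies.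
Context {R : realType} (T : R).
Hypothesis T0 : 0 < T.
Implicit Types (s t : R) (n m : int).

Definition wave n t : R[i]^o := expi (freq T n * t).

Lemma freqD n m : freq T (n + m) = freq T n + freq T m.
Proof. by rewrite /freq intrD mulrDr mulrDl. Qed.

Lemma freqN n : freq T (- n) = - freq T n.
Proof. by rewrite /freq mulrNz mulrN mulNr. Qed.

Lemma freqE n : `|freq T n| = 2 * pi / T * `|n|%N%:R.
Proof.
rewrite /freq !normrM normfV (gtr0_norm T0) (gtr0_norm (pi_gt0 R)).
rewrite ger0_norm// [RHS]mulrAC; congr (_ * _ / _).
by rewrite natr_absz intr_norm.
Qed.

Lemma waveD n m t : wave (n + m) t = (wave n t : R[i]) * wave m t.
Proof. by rewrite /wave freqD mulrDl expiD. Qed.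

Lemma wave_shift n s t : wave n (s + t) = (wave n s : R[i]) * wave n t.
Proof. by rewrite /wave mulrDr expiD. Qed.

Lemma wave0 t : wave 0 t = 1.
Proof. by rewrite /wave /freq mulr0 !mul0r expi0. Qed.

Lemma wave_at0 n : wave n 0 = 1.
Proof. by rewrite /wave mulr0 expi0. Qed.

Lemma wave_atT n : wave n T = 1.
Proof. by rewrite /wave /freq divfK ?gt_eqF// expi2pi. Qed.

Lemma wave_periodic n : periodic (wave n) T.
Proof. by move=> t; rewrite wave_shift wave_atT mulr1. Qed.

Lemma rnorm_wave n t : rnorm (wave n t) = 1.
Proof. exact: rnorm_expi. Qed.

Lemma tderiv_wave n t : is_tderiv (wave n) t (ifreq T n * (wave n t : R[i])).
Proof. exact: tderiv_expi. Qed.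

Lemma wave_continuous n : continuous (wave n).
Proof. by move=> t; exact: tderiv_continuous (@tderiv_wave n t). Qed.

Lemma wave1_neq1 t : 0 < `|t| < T -> wave 1 t != 1.
Proof.
have pos s : 0 < s < T -> wave 1 s != 1.
  move=> /andP[s0 sT]; apply: expi_neq1; rewrite /freq mulr1.
  have p0 : 0 < 2 * pi :> R by rewrite mulr_gt0// pi_gt0.
  rewrite mulr_gt0 ?divr_gt0//= (_ : pi *+ 2 = 2 * pi); last by rewrite mulr_natl.
  by rewrite mulrAC ltr_pdivrMr// ltr_pM2l.
have [t0|t0|->] := ltgtP t 0; last by rewrite normr0 ltxx.
  rewrite ltr0_norm// => /pos; apply: contraNN => /eqP t1.
  have := wave_shift 1 (- t) t.
  by rewrite addNr wave_at0 t1 mulr1 => <-.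
by rewrite gtr0_norm// => /pos.
Qed.

End Frequencies.

(** * Fourier coefficients *)

Section FourierCoefficients.
Context {R : realType} {V : completeNormedModType R[i]} (T : R).
Hypothesis T0 : 0 < T.
Implicit Types (t K e : R) (n m : int) (f g : R -> V) (y : V).

Lemma within_wave_scale (A : set R) f n : {within A, continuous f} ->
  {within A, continuous (fun t => (wave T n t : R[i]) *: f t)}.
Proof.
move=> fc t; apply: cvgZ; last exact: fc.
have := continuous_subspaceT (@wave_continuous R T n); exact.
Qed.

Lemma within_scale_cst (A : set R) f (c : R[i]) : {within A, continuous f} ->
  {within A, continuous (fun t => c *: f t)}.
Proof. by move=> fc t; apply: cvgZ; [exact: cvg_cst|exact: fc]. Qed.

Lemma rnorm_waveZ n t y : rnorm ((wave T n t : R[i]) *: y) = rnorm y.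
Proof. by rewrite rnormZ -rnorm_scalar rnorm_wave mul1r. Qed.

Definition fourier f n : V :=
  (T^-1)%:C *: Rint 0 T (fun t => (wave T (- n) t : R[i]) *: f t).

Lemma fourierB f g n : {within `[0, T], continuous f} ->
  {within `[0, T], continuous g} ->
  fourier (fun t => f t - g t) n = fourier f n - fourier g n.
Proof.
move=> fc gc; have wf := within_wave_scale (n := - n) fc.
have wg := within_wave_scale (n := - n) gc.
rewrite /fourier -scalerBr (_ : (fun t => _) = (fun t =>
    (wave T (- n) t : R[i]) *: f t + (-1) *: ((wave T (- n) t : R[i]) *: g t))).
  rewrite RintD ?ltW//; last exact: within_scale_cst.
  by rewrite RintZ ?ltW// scaleN1r.
by apply/funext => t; rewrite scaleN1r scalerBr.
Qed.

Lemma fourierZ (c : R[i]) f n : {within `[0, T], continuous f} ->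
  fourier (fun t => c *: f t) n = c *: fourier f n.
Proof.
move=> fc; rewrite /fourier scalerA mulrC -scalerA; congr (_ *: _).
rewrite -RintZ ?ltW//; last exact: within_wave_scale.
by congr (Rint _ _ _); apply/funext => t; rewrite !scalerA mulrC.
Qed.

(** Multiplication by a wave shifts the coefficients: this is what makes the sums
    in the inversion argument telescope. *)
Lemma fourier_modulate f n m :
  fourier (fun t => (wave T m t : R[i]) *: f t) n = fourier f (n - m).
Proof.
congr (_ *: Rint _ _ _); apply/funext => t.
by rewrite scalerA opprB addrC waveD.
Qed.

Lemma rnorm_fourier f n K : {within `[0, T], continuous f} ->
  (forall t, t \in `[0, T] -> rnorm (f t) <= K) -> rnorm (fourier f n) <= K.
Proof.
move=> fc fK; rewrite rnormZr ger0_norm ?invr_ge0 ?(ltW T0)//.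
rewrite ler_pdivrMl//.
have := @rnorm_Rint R V 0 T _ K (ltW T0) (within_wave_scale (n := - n) fc).
by rewrite subr0; apply => t tT; rewrite rnorm_waveZ fK.
Qed.

Lemma tderiv_wave_scale f g n t : is_tderiv f t (g t) ->
  is_tderiv (fun t => (wave T n t : R[i]) *: f t) t
    (ifreq T n *: ((wave T n t : R[i]) *: f t) + (wave T n t : R[i]) *: g t).
Proof.
by move=> fg; have := tderiv_scale (@tderiv_wave R T n t) fg; rewrite scalerA.
Qed.

Lemma ifreqN n : ifreq T (- n) = - ifreq T n.
Proof. by rewrite /ifreq freqN; simpc. Qed.

Lemma freq_eq0 n : (freq T n == 0) = (n == 0).
Proof.
by rewrite /freq !mulf_eq0 invr_eq0 intr_eq0 pnatr_eq0 (gt_eqF T0)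
  (gt_eqF (pi_gt0 R)) orbF.
Qed.

Lemma ifreq_eq0 n : (ifreq T n == 0) = (n == 0).
Proof. by rewrite eq_complex /= eqxx freq_eq0. Qed.

(** Integration by parts: the boundary terms cancel by periodicity. *)
Lemma fourier_deriv f g n : periodic f T -> (forall t, is_tderiv f t (g t)) ->
  continuous g -> fourier g n = ifreq T n *: fourier f n.
Proof.
move=> fT fg gc; have fc : continuous f.
  by move=> t; exact: tderiv_continuous (fg t).
have wc h : continuous h ->
    {within `[0, T], continuous (fun t => (wave T (- n) t : R[i]) *: (h t : V))}.
  by move=> hc; apply: within_wave_scale; exact: continuous_subspaceT.
have icst (c : R[i]) h : continuous h -> {within `[0, T], continuous
    (fun t => c *: ((wave T (- n) t : R[i]) *: (h t : V)))}.
  by move=> hc; apply: within_scale_cst; exact: wc.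
have := @Rint_ftc R V 0 T _ _ (ltW T0) (fun t => tderiv_wave_scale (n := - n) (fg t)).
rewrite wave_at0 wave_atT// -[in f T](add0r T) fT subrr RintD ?ltW//; last 2 first.
- exact: icst.
- exact: wc.
rewrite RintZ ?ltW//; last exact: wc.
move=> H; have := H _; rewrite ifreqN scaleNr => {}H.
rewrite /fourier scalerA mulrC -scalerA; congr (_ *: _).
apply/eqP; rewrite -subr_eq0 addrC H//.
exact: (within_continuousD (icst _ _ fc) (wc _ gc)).
Qed.

(** For n <> 0 the derivative of a constant vanishes, and so does i w_n times its
    coefficient. *)
Lemma fourier_cst y n : fourier (fun=> y) n = if n == 0 then y else 0.
Proof.
have cc : continuous (fun _ : R => y) by move=> t; exact: cvg_cst.
have cw := continuous_subspaceT cc.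
have [->|n0] := eqVneq n 0.
  rewrite /fourier (_ : (fun t => _) = (fun=> y)); last first.
    by apply/funext => t; rewrite oppr0 wave0 scale1r.
  have := @Rint_near R V 0 T (fun=> y) y 0 (ltW T0) (cw _).
  rewrite mulr0 subr0 => H.
  have /subr0_eq -> : Rint 0 T (fun=> y) - T%:C *: y = 0.
    apply/rnorm0_eq0/eqP; rewrite eq_le rnorm_ge0 andbT; apply: H => t _.
    by rewrite subrr rnorm0.
  by rewrite scalerA -rmorphM /= mulVf ?gt_eqF// scale1r.
have := @fourier_deriv (fun=> y) (fun=> 0) n (fun=> erefl)
  (fun t => tderiv_cst y t).
have c0 : continuous (fun _ : R => 0 : V) by move=> t; exact: cvg_cst.
move=> /(_ c0).
have -> : fourier (fun=> 0) n = 0.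
  apply/rnorm0_eq0/eqP; rewrite eq_le rnorm_ge0 andbT.
  apply: rnorm_fourier => [|t _]; last by rewrite rnorm0.
  exact: continuous_subspaceT.
move=> /esym/eqP; rewrite scaler_eq0 => /orP[|/eqP//].
by rewrite ifreq_eq0 (negbTE n0).
Qed.

End FourierCoefficients.

Lemma pow1D_le {R : realType} (x : R) p : 0 <= x ->
  (1 + x) ^+ p <= 2 ^+ p * (1 + x ^+ p).
Proof.
move=> x0; have x1 : 0 <= 1 + x by rewrite addr_ge0.
rewrite mulrDr mulr1; have [xle|xgt] := leP x 1.
  apply: (@le_trans _ _ (2 ^+ p)); last by rewrite lerDl mulr_ge0// exprn_ge0.
  by apply: lerXn2r; rewrite ?nnegrE//; lra.
rewrite -exprMn; apply: (@le_trans _ _ ((2 * x) ^+ p)).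
  by apply: lerXn2r; rewrite ?nnegrE//; lra.
by rewrite lerDr exprn_ge0.
Qed.

Section SmoothPeriodic.
Context {R : realType} {V : normedModType R[i]} (T : R).
Implicit Types (t : R) (f g : R -> V) (k : nat).

Lemma periodic_tderiv f g : periodic f T -> (forall t, is_tderiv f t (g t)) ->
  periodic g T.
Proof.
move=> fT fg t; apply: (@tderiv_unique _ _ f t); last exact: fg.
have := fg (t + T); rewrite /is_tderiv (_ : (fun h => _) =
  (fun h => (h^-1)%:C *: (f (t + h) - f t)))//.
by apply/funext => h; rewrite addrAC !fT.
Qed.

Lemma smooth_periodicP f : smooth_periodic T f -> exists g : nat -> R -> V,
  [/\ g 0%N = f, forall k t, is_tderiv (g k) t (g k.+1 t),
      forall k, periodic (g k) T & forall k, continuous (g k)].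
Proof.
move=> [fT [g [g0 gd]]]; exists g; split => //.
  elim=> [|k IHk]; first by rewrite g0.
  exact: periodic_tderiv IHk (gd k).
by move=> k t; exact: tderiv_continuous (gd k t).
Qed.

End SmoothPeriodic.

Section Decay.
Context {R : realType} {V : completeNormedModType R[i]} (T : R).
Hypothesis T0 : 0 < T.
Implicit Types (t K e : R) (n m : int) (f g : R -> V) (y : V) (k p : nat).

Lemma rnorm_ifreqZ n k y :
  rnorm (ifreq T n ^+ k *: y) = `|freq T n| ^+ k * rnorm y.
Proof.
elim: k => [|k IHk]; first by rewrite !expr0 scale1r mul1r.
rewrite !exprS -scalerA rnormZ IHk mulrA; congr (_ * _ * _).
by rewrite /= expr0n add0r sqrtr_sqr.
Qed.

Lemma fourier_iter (g : nat -> R -> V) n k :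
  (forall k t, is_tderiv (g k) t (g k.+1 t)) ->
  (forall k, periodic (g k) T) -> (forall k, continuous (g k)) ->
  fourier T (g k) n = ifreq T n ^+ k *: fourier T (g 0%N) n.
Proof.
move=> gd gT gc; elim: k => [|k IHk]; first by rewrite scale1r.
by rewrite (fourier_deriv T0 _ (gT k) (gd k) (gc _)) IHk scalerA exprS.
Qed.

(** The coefficients of the p-th derivative are bounded, and they are (i w_n)^p
    times those of f. *)
Lemma fourier_decay f p : smooth_periodic T f -> exists2 K, 0 <= K &
  forall n, rnorm (fourier T f n) * (1 + `|freq T n|) ^+ p <= K.
Proof.
move=> /smooth_periodicP[g [g0 gd gT gc]].
have gw k : {within `[0, T], continuous (g k)} by exact: continuous_subspaceT.
have [K0 K00 hK0] := itv_bounded (gw 0%N).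
have [Kp Kp0 hKp] := itv_bounded (gw p).
exists (2 ^+ p * (K0 + Kp)) => [|n].
  by rewrite mulr_ge0 ?addr_ge0// exprn_ge0.
apply: le_trans (ler_wpM2l (rnorm_ge0 _) (pow1D_le p (normr_ge0 _))) _.
rewrite mulrCA ler_wpM2l ?exprn_ge0// mulrDr mulr1 lerD//.
  by rewrite -g0; apply: rnorm_fourier.
by rewrite mulrC -rnorm_ifreqZ -g0 -fourier_iter//; apply: rnorm_fourier.
Qed.

End Decay.

(** * Series indexed by the integers *)

Section IntegerSeries.
Context {R : realType} {V : completeNormedModType R[i]} (T : R).
Hypothesis T0 : 0 < T.
Implicit Types (a b : int -> V) (K : R) (N M j : nat) (n : int).

(** Posz j and Negz j are the integers j and - (j + 1), so the N-th partial sum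
    runs over the integers from - N to N - 1. *)
Definition zpsum a N : V := \sum_(0 <= j < N) (a (Posz j) + a (Negz j)).

Lemma zpsumS a N : zpsum a N.+1 = zpsum a N + (a (Posz N) + a (Negz N)).
Proof. by rewrite /zpsum big_nat_recr. Qed.

Definition zsum a : V := lim (zpsum a N @[N --> \oo]).

(** The factor (1 + T / 2 pi)^2 comes from comparing 1 + |n| with 1 + |w_n|, and 4
    from the two signs and from (j + 1)(j + 2) <= 2 (j + 1)^2. *)
Definition zsum_bound K : R := 4 * K * (1 + T / (2 * pi)) ^+ 2.

Lemma index_le_freq n : 1 + `|n|%N%:R <= (1 + T / (2 * pi)) * (1 + `|freq T n|).
Proof.
rewrite freqE//; set x := `|n|%N%:R.
have : 0 < 2 * pi :> R by rewrite mulr_gt0// pi_gt0.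
move: (2 * pi) => q q0.
have -> : (1 + T / q) * (1 + q / T * x) = 1 + x + (T / q + q / T * x).
  by field; rewrite !gt_eqF.
by rewrite lerDl addr_ge0 ?mulr_ge0 ?invr_ge0 ?ler0n ?(ltW q0) ?(ltW T0).
Qed.

(** Bounding the terms by a telescoping difference makes the tails of the series
    explicit. *)
Lemma term_bound a K j n : (j <= `|n|)%N ->
  rnorm (a n) * (1 + `|freq T n|) ^+ 2 <= K ->
  rnorm (a n) <= 2 * K * (1 + T / (2 * pi)) ^+ 2 * (j.+1%:R^-1 - j.+2%:R^-1).
Proof.
move=> jn aK; set c := 1 + T / (2 * pi).
have c0 : 0 <= c by rewrite addr_ge0// divr_ge0 ?(ltW T0)// mulr_ge0// pi_ge0.
have h : j.+1%:R <= c * (1 + `|freq T n|).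
  apply: le_trans (index_le_freq n).
  by rewrite -natr1 addrC lerD2l ler_nat.
have j0 : 0 < j.+1%:R :> R by rewrite ltr0n.
have h2 : rnorm (a n) * j.+1%:R ^+ 2 <= K * c ^+ 2.
  apply: (@le_trans _ _ (rnorm (a n) * (c * (1 + `|freq T n|)) ^+ 2)).
    rewrite ler_wpM2l ?rnorm_ge0//; apply: lerXn2r => //; rewrite nnegrE ?(ltW j0)//.
    by rewrite mulr_ge0// addr_ge0.
  by rewrite exprMn mulrCA mulrC ler_wpM2r// sqr_ge0.
have j20 : j.+2%:R = j.+1%:R + 1 :> R by rewrite natr1.
have -> : 2 * K * c ^+ 2 * (j.+1%:R^-1 - j.+2%:R^-1) =
    (K * c ^+ 2) * (2 / (j.+1%:R * (j.+1%:R + 1))).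
  rewrite j20; move: j0; move: (j.+1%:R) => q q0.
  by field; rewrite !gt_eqF// addr_gt0.
apply: le_trans (ler_wpM2r _ h2); last first.
  by rewrite divr_ge0// mulr_ge0// ?addr_ge0// ltW.
rewrite -mulrA -[leLHS]mulr1 ler_wpM2l ?rnorm_ge0// mulrA ler_pdivlMr; last first.
  by rewrite mulr_gt0// addr_gt0.
rewrite mul1r expr2 -mulrA ler_wpM2l ?(ltW j0)//.
have : (1 : R) <= j.+1%:R by rewrite ler1n.
lra.
Qed.

(** Quadratic decay in the frequency, the weakest integral power for which the
    series converges absolutely. *)
Definition decays a K := forall n, rnorm (a n) * (1 + `|freq T n|) ^+ 2 <= K.

Lemma zpsum_tail a K N M : decays a K -> (N <= M)%N ->
  rnorm (zpsum a M - zpsum a N) <= zsum_bound K * (N.+1%:R^-1 - M.+1%:R^-1).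
Proof.
move=> aK; elim: M => [|M IHM].
  by rewrite leqn0 => /eqP ->; rewrite !subrr rnorm0 mulr0.
rewrite leq_eqVlt => /orP[/eqP ->|]; first by rewrite !subrr rnorm0 mulr0.
rewrite ltnS => /IHM{}IHM; rewrite zpsumS addrAC.
apply: le_trans (ler_rnormD _ _) _.
have -> : zsum_bound K * (N.+1%:R^-1 - M.+2%:R^-1) =
  zsum_bound K * (N.+1%:R^-1 - M.+1%:R^-1) + zsum_bound K * (M.+1%:R^-1 - M.+2%:R^-1).
  by ring.
rewrite lerD//; apply: le_trans (ler_rnormD _ _) _.
have h1 := @term_bound a K M (Posz M) (leqnn _) (aK _).
have h2 := @term_bound a K M (Negz M) (leqnSn _) (aK _).
apply: le_trans (lerD h1 h2) _; rewrite -mulrDl le_eqVlt; apply/orP; left.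
by apply/eqP; rewrite /zsum_bound; congr (_ * _); ring.
Qed.

Lemma decays_ge0 a K : decays a K -> 0 <= K.
Proof. by move=> /(_ 0); apply: le_trans; rewrite mulr_ge0 ?rnorm_ge0 ?sqr_ge0. Qed.

Lemma zsum_bound_ge0 K : 0 <= K -> 0 <= zsum_bound K.
Proof. by move=> K0; rewrite mulr_ge0 ?sqr_ge0// mulr_ge0. Qed.

Lemma zsum_cvg a K : decays a K -> zpsum a N @[N --> \oo] --> zsum a.
Proof.
move=> aK; have [l al] : exists l : V, zpsum a N @[N --> \oo] --> l.
  apply: cauchy_rnorm => e e0; exists (Num.truncn (zsum_bound K / e)) => M NM.
  apply: le_trans (zpsum_tail aK NM) _.
  have B0 := zsum_bound_ge0 (decays_ge0 aK).
  apply: (@le_trans _ _ (zsum_bound K * (Num.truncn (zsum_bound K / e)).+1%:R^-1)).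
    by rewrite ler_wpM2l// gerBl invr_ge0.
  by rewrite ler_pdivrMr// mulrC -ler_pdivrMr// ltW// truncnS_gt.
by rewrite /zsum (cvg_lim _ al).
Qed.

Lemma rnorm_zsum a K : decays a K -> rnorm (zsum a) <= zsum_bound K.
Proof.
move=> aK; apply: rnorm_lim_le (zsum_cvg aK) _; near=> N.
have := zpsum_tail aK (leq0n N); rewrite {2}/zpsum big_nil subr0.
move/le_trans; apply; rewrite -[leRHS]mulr1 ler_wpM2l ?zsum_bound_ge0 ?(decays_ge0 aK)//.
by rewrite invr1 gerBl invr_ge0.
Unshelve. all: by end_near. Qed.

Lemma zsum_unique a l : zpsum a N @[N --> \oo] --> l -> zsum a = l.
Proof. exact: cvg_lim. Qed.

End IntegerSeries.

(** * Termwise differentiation *)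

Section Taylor.
Context {R : realType} {V : normedModType R[i]}.
Implicit Types (f g k : R -> V) (t h : R) (l : V).

Lemma mean_value_abs f g (K : R) a b : (forall t, is_tderiv f t (g t)) ->
  (forall t, rnorm (g t) <= K) -> rnorm (f b - f a) <= K * `|b - a|.
Proof.
move=> fg gK; have [ab|/ltW ba] := leP a b.
  by rewrite ger0_norm ?subr_ge0//; apply: mean_value fg _.
by rewrite rnorm_distC distrC ger0_norm ?subr_ge0//; apply: mean_value fg _.
Qed.

Lemma tderiv_linear l (c t : R) : is_tderiv (fun s => (s - c)%:C *: l) t l.
Proof.
apply/tderivP => e e0; near=> h; rewrite -!scalerBl -!rmorphB /=.
have -> : t + h - c - (t - c) - h = 0 by ring.
by rewrite scale0r rnorm0 mulr_ge0// ltW.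
Unshelve. all: by end_near. Qed.

(** The mean value inequality twice: once for g, which bounds the derivative
    g(s) - g(t) of f minus its tangent at t, and once for that difference. *)
Lemma taylor1 f g k (K : R) t h : (forall t, is_tderiv f t (g t)) ->
  (forall t, is_tderiv g t (k t)) -> (forall t, rnorm (k t) <= K) ->
  rnorm (f (t + h) - f t - h%:C *: g t) <= K * h ^+ 2.
Proof.
move=> fg gk kK; have K0 : 0 <= K := le_trans (rnorm_ge0 _) (kK 0).
pose F s := f s - (s - t)%:C *: g t.
have dF s : is_tderiv F s (g s - g t).
  by apply: tderivB; [exact: fg|exact: tderiv_linear].
have gK s : `|s - t| <= `|h| -> rnorm (g s - g t) <= K * `|h|.
  by move=> st; apply: le_trans (mean_value_abs _ _ gk kK) _; rewrite ler_wpM2l.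
have -> : f (t + h) - f t - h%:C *: g t = F (t + h) - F t.
  by rewrite /F subrr scale0r subr0 addrAC [t + h - t]addrAC subrr add0r.
have -> : K * h ^+ 2 = K * `|h| * `|h| by rewrite -mulrA -normrM ger0_norm// sqr_ge0.
have [h0|/ltW h0] := leP 0 h.
  rewrite -[X in _ <= _ * X](_ : t + h - t = `|h|); last first.
    by rewrite ger0_norm// addrAC subrr add0r.
  apply: (mean_value _ dF) => [|s /andP[ts sth]]; first by rewrite lerDl.
  by apply: gK; rewrite !ger0_norm ?subr_ge0//; lra.
rewrite rnorm_distC -[X in _ <= _ * X](_ : t - (t + h) = `|h|); last first.
  by rewrite ler0_norm//; ring.
apply: (mean_value _ dF) => [|s /andP[ts sth]]; first by lra.
by apply: gK; rewrite !ler0_norm ?subr_le0//; lra.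
Qed.

Lemma tderiv_quadratic f t l (B : R) :
  (forall h, rnorm (f (t + h) - f t - h%:C *: l) <= B * h ^+ 2) ->
  is_tderiv f t l.
Proof.
move=> fB; have B0 : 0 <= B.
  by apply: le_trans (rnorm_ge0 _) _; last have := fB 1; rewrite expr1n mulr1; exact.
apply/tderivP => e e0; apply/nbhs_ballP.
have B1 : 0 < B + 1 by rewrite ltr_pwDr.
exists (e / (B + 1)); first by rewrite /= divr_gt0.
move=> h; rewrite /ball /= sub0r normrN ltr_pdivlMr// => he.
apply: le_trans (fB h) _.
rewrite -[h ^+ 2]ger0_norm ?sqr_ge0// normrM mulrA ler_wpM2r//.
by apply: le_trans (ltW he); rewrite mulrC ler_wpM2l// lerDl.
Qed.

End Taylor.

Section TermwiseDerivative.
Context {R : realType} {V : completeNormedModType R[i]} (T : R).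
Hypothesis T0 : 0 < T.
Implicit Types (t h K : R) (n : int) (y : int -> V).

Definition wave_series y t : V := zsum (fun n => (wave T n t : R[i]) *: y n).

Lemma tderiv_waveZ n t (x : V) : is_tderiv (fun s => (wave T n s : R[i]) *: x) t
  ((wave T n t : R[i]) *: (ifreq T n *: x)).
Proof.
have := tderiv_scale_cst (x := x) (@tderiv_wave R T n t).
by rewrite [_ * _]mulrC -scalerA.
Qed.

Lemma wave_taylor n t h (x : V) :
  rnorm ((wave T n (t + h) : R[i]) *: x - (wave T n t : R[i]) *: x
    - h%:C *: ((wave T n t : R[i]) *: (ifreq T n *: x)))
  <= (`|freq T n| ^+ 2 * rnorm x) * h ^+ 2.
Proof.
apply: (@taylor1 R V (fun s => (wave T n s : R[i]) *: x)
  (fun s => (wave T n s : R[i]) *: (ifreq T n *: x))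
  (fun s => (wave T n s : R[i]) *: (ifreq T n *: (ifreq T n *: x)))).
- by move=> s; exact: tderiv_waveZ.
- by move=> s; exact: tderiv_waveZ.
- by move=> s; rewrite rnorm_waveZ scalerA -expr2 rnorm_ifreqZ.
Qed.

(** Each power of the frequency by which a term exceeds the coefficient costs one
    order of decay. *)
Lemma le_decays y K p (a : int -> V) :
  (forall n, rnorm (y n) * (1 + `|freq T n|) ^+ p.+2 <= K) ->
  (forall n, rnorm (a n) <= rnorm (y n) * (1 + `|freq T n|) ^+ p) ->
  decays T a K.
Proof.
move=> yK ay n; apply: le_trans (yK n).
by rewrite -(addn2 p) (exprD _ p 2) [leRHS]mulrA ler_wpM2r ?sqr_ge0.
Qed.

Lemma zsumB (a b : int -> V) Ka Kb : decays T a Ka -> decays T b Kb ->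
  zsum (fun n => a n - b n) = zsum a - zsum b.
Proof.
move=> aK bK; apply: zsum_unique.
rewrite (_ : zpsum _ = fun N => zpsum a N - zpsum b N).
  by apply: cvgB; [exact: zsum_cvg aK|exact: zsum_cvg bK].
apply/funext => N; rewrite -sumrB; apply: eq_bigr => j _.
by rewrite opprD addrACA.
Qed.

Lemma zsumZ (c : R[i]) (a : int -> V) K : decays T a K ->
  zsum (fun n => c *: a n) = c *: zsum a.
Proof.
move=> aK; apply: zsum_unique.
rewrite (_ : zpsum _ = fun N => c *: zpsum a N).
  by apply: cvgZ; [exact: cvg_cst|exact: zsum_cvg aK].
apply/funext => N; rewrite scaler_sumr; apply: eq_bigr => j _.
by rewrite scalerDr.
Qed.

(** The second order remainders of the terms sum to a multiple of h^2, and four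
    orders of decay pay for two derivatives and for absolute convergence. *)
Lemma tderiv_wave_series y K t :
  (forall n, rnorm (y n) * (1 + `|freq T n|) ^+ 4 <= K) ->
  is_tderiv (wave_series y) t (wave_series (fun n => ifreq T n *: y n) t).
Proof.
move=> yK; apply: (@tderiv_quadratic _ _ _ _ _ (zsum_bound T K)) => h.
have w1 n : 1 <= 1 + `|freq T n| by rewrite lerDl.
have d1 s : decays T (fun n => (wave T n s : R[i]) *: y n) K.
  apply: (le_decays yK) => n.
  by rewrite rnorm_waveZ ler_peMr ?rnorm_ge0// exprn_ege1.
have d2 : decays T (fun n => (wave T n t : R[i]) *: (ifreq T n *: y n)) K.
  apply: (le_decays yK) => n.
  rewrite rnorm_waveZ -[ifreq T n]expr1 rnorm_ifreqZ mulrC ler_wpM2l ?rnorm_ge0//.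
  by rewrite expr1 expr2 (le_trans (y := 1 + `|freq T n|)) ?lerDr// ler_peMr.
have d3 : decays T (fun n => h%:C *: ((wave T n t : R[i]) *: (ifreq T n *: y n)))
    (`|h| * K).
  by move=> n; rewrite rnormZr -mulrA ler_wpM2l.
have d4 : decays T (fun n => (wave T n (t + h) : R[i]) *: y n
    - (wave T n t : R[i]) *: y n) (K + K).
  move=> n; apply: le_trans (lerD (d1 (t + h) n) (d1 t n)).
  by rewrite -mulrDl ler_wpM2r ?sqr_ge0// ler_rnormB.
rewrite /wave_series -(zsumZ _ d2) -(zsumB (d1 _) (d1 _)) -(zsumB d4 d3).
have -> : zsum_bound T K * h ^+ 2 = zsum_bound T (K * h ^+ 2) by rewrite /zsum_bound; ring.
apply: (rnorm_zsum T0) => n; apply: le_trans (ler_wpM2r _ (wave_taylor n t h (y n))) _.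
  exact: sqr_ge0.
rewrite mulrAC ler_wpM2r ?sqr_ge0//; apply: le_trans (yK n).
rewrite [`|_| ^+ 2 * _]mulrC -mulrA ler_wpM2l ?rnorm_ge0// (exprD _ 2 2).
rewrite ler_wpM2r ?sqr_ge0//.
by apply: lerXn2r; rewrite ?nnegrE ?addr_ge0// lerDr.
Qed.

End TermwiseDerivative.

(** * Fourier inversion *)

Section FourierInversion.
Context {R : realType} {V : completeNormedModType R[i]} (T : R).
Hypothesis T0 : 0 < T.
Implicit Types (t s e K : R) (n : int) (f h : R -> V) (y : V).

(** The constant part y of h is integrated exactly by the primitive wave / (i w_n),
    which gains a factor 1 / |w_n|; the rest is small. *)
Lemma oscillatory_bound h n (a b e : R) y : n != 0 -> a <= b ->
  {within `[a, b], continuous h} ->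
  (forall t, t \in `[a, b] -> rnorm (h t - y) <= e) ->
  rnorm (Rint a b (fun t => (wave T n t : R[i]) *: h t)) <=
    (b - a) * e + 2 * rnorm y / `|freq T n|.
Proof.
move=> n0 ab hc hy; have in0 : ifreq T n != 0 by rewrite ifreq_eq0.
have w0 : 0 < `|freq T n| by rewrite normr_gt0 freq_eq0.
have cc : {within `[a, b], continuous (fun _ : R => y)}.
  by apply: continuous_subspaceT => t; exact: cvg_cst.
have hyc : {within `[a, b], continuous (fun t => h t - y)}.
  exact: (within_continuousB hc cc).
rewrite (_ : (fun t => _) = (fun t => (wave T n t : R[i]) *: (h t - y)
    + (wave T n t : R[i]) *: y)); last first.
  by apply/funext => t; rewrite -scalerDr subrK.
rewrite RintD//; [|exact: within_wave_scale..].
apply: le_trans (ler_rnormD _ _) _; rewrite lerD//.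
  apply: rnorm_Rint => //; first exact: within_wave_scale.
  by move=> t tab; rewrite rnorm_waveZ hy.
set z := (ifreq T n)^-1 *: y; have yz : y = ifreq T n *: z.
  by rewrite scalerA divff// scale1r.
have zy : rnorm z = rnorm y / `|freq T n|.
  by rewrite yz -[ifreq T n]expr1 rnorm_ifreqZ expr1 mulrC mulKf// gt_eqF.
rewrite (@Rint_ftc _ _ a b (fun t => (wave T n t : R[i]) *: z))//; last 2 first.
- by move=> t; rewrite yz; exact: tderiv_waveZ.
- exact: within_wave_scale.
apply: le_trans (ler_rnormB _ _) _.
by rewrite !rnorm_waveZ zy -mulrA mulr_natl mulr2n.
Qed.

(** On each cell of a fine partition the function is nearly constant, and a
    wave times a constant integrates to at most a multiple of 1/n. *)
Lemma riemann_lebesgue h e : {within `[0, T], continuous h} -> 0 < e ->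
  exists N, forall n, (N <= `|n|)%N -> rnorm (fourier T h n) <= e.
Proof.
move=> hc e0; have e20 : 0 < e / 2 by rewrite divr_gt0.
have [K K0 hK] := itv_bounded hc.
have [m hm] := mesh_oscillation (ltW T0) hc e20.
have pi0 := pi_gt0 R.
(* 2 ^ m cells, each contributing at most 2 K / |w_n| beyond the oscillation *)
pose D := 2 ^+ m * (2 * K).
exists (Num.truncn (D / (e * pi))).+1 => n Nn.
have n0 : n != 0 by rewrite -absz_gt0 (leq_trans _ Nn).
have w0 : 0 < `|freq T n| by rewrite normr_gt0 freq_eq0.
have Dn : D <= e / 2 * (T * `|freq T n|).
  have -> : e / 2 * (T * `|freq T n|) = e * pi * `|n|%N%:R.
    rewrite freqE//; move: (@pi R) => q; by field; rewrite gt_eqF.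
  rewrite mulrC -ler_pdivrMr ?mulr_gt0//.
  by apply: le_trans (ltW (truncnS_gt _)) _; rewrite ler_nat.
rewrite rnormZr ger0_norm ?invr_ge0 ?(ltW T0)// ler_pdivrMl//.
rewrite (Rint_split m (ltW T0)); last exact: within_wave_scale.
apply: le_trans (ler_rnorm_sum _ _ _) _.
apply: (@le_trans _ _ (\sum_(0 <= k < (2 ^ m)%N)
    (mesh 0 T m * (e / 2) + 2 * K / `|freq T n|))).
  rewrite big_nat [leRHS]big_nat; apply: ler_sum => k /andP[_ k2].
  have -> : mesh 0 T m = node 0 T m k.+1 - node 0 T m k.
    by rewrite nodeS addrAC subrr add0r.
  apply: le_trans (oscillatory_bound (y := h (node 0 T m k)) (e := e / 2) _ _ _ _) _.
  - by rewrite oppr_eq0.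
  - by apply: node_le; rewrite // ltW.
  - by apply: continuous_subspaceW hc => t /=; apply: cell_sub; rewrite // ltW.
  - by move=> t tk; apply: hm.
  rewrite freqN normrN lerD2l ler_wpM2r ?invr_ge0//.
  by rewrite ler_wpM2l// hK//; apply: node_itv; rewrite ?(ltW T0)// ltnW.
rewrite sumr_const_nat subn0 mulrnDl -mulrnAl mesh_total subr0.
rewrite -[_ / _ *+ _]mulr_natl natrX [2 ^+ m * _]mulrA -/D.
have : D / `|freq T n| <= e / 2 * T by move: Dn; rewrite mulrA ler_pdivrMr.
by move: (D / _) => q; lra.
Qed.

(** The difference quotient against the first wave. Its value at [t0] makes it
    continuous there. *)
Definition wave_quotient f y t0 t : V :=
  if t == t0 then (ifreq T 1)^-1 *: y
  else (wave T 1 (t - t0) - 1 : R[i])^-1 *: (f t - f t0).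

Lemma wave_quotientK f y t0 t : `|t - t0| < T ->
  f t - f t0 = (wave T 1 (t - t0) - 1 : R[i]) *: wave_quotient f y t0 t.
Proof.
move=> tT; rewrite /wave_quotient; have [->|neq] := eqVneq t t0.
  by rewrite !subrr wave_at0 subrr scale0r.
rewrite scalerA divff ?scale1r// subr_eq0.
by apply: wave1_neq1; rewrite // normr_gt0 subr_eq0 neq.
Qed.

(** Both f - f(t0) and the shifted wave minus 1 vanish at t0, so near t0 the
    quotient is one of difference quotients, and 0 < t0 < T keeps the other
    zeros of the denominator out of [0, T]. *)
Lemma wave_quotient_continuous f y t0 : 0 < t0 < T -> is_tderiv f t0 y ->
  continuous f -> {within `[0, T], continuous (wave_quotient f y t0)}.
Proof.
move=> /andP[t00 t0T] fy fc; apply: continuous_in_subspaceT => t.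
rewrite inE /= in_itv /= => /andP[ta tb].
have [->|neq] := eqVneq t t0.
  have w1 : ifreq T 1 != 0 by rewrite ifreq_eq0.
  have Q : (wave T 1 r - 1 : R[i])^-1 *: (f (t0 + r) - f t0) @[r --> 0^'] -->
      (ifreq T 1)^-1 *: y.
    have wd : ((r^-1)%:C * (wave T 1 r - 1) : R[i]^o) @[r --> 0^'] --> (ifreq T 1 : R[i]^o).
      have := @tderiv_wave R T 1 0; rewrite /is_tderiv wave_at0 mulr1.
      by under eq_fun do rewrite add0r.
    apply: cvg_trans (cvgZ (cvgV w1 wd) fy); apply: near_eq_cvg.
    rewrite near_withinE; apply: nearW => r r0.
    have c0 : (r^-1)%:C != 0 :> R[i] by rewrite fmorph_eq0 invr_eq0.
    rewrite scalerA /=; congr (_ *: _).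
    by rewrite [X in X * _](invfM (r^-1)%:C) mulrAC mulVf// mul1r.
  apply/cvg_rnormP => e e0; move/cvg_rnormP: Q => /(_ e e0).
  rewrite near_withinE => /nbhs_ballP[d /= d0 hd].
  apply/nbhs_ballP; exists d => //= s; rewrite /ball /= => sd.
  rewrite /wave_quotient eqxx; have [_|sneq] := eqVneq s t0.
    by rewrite subrr rnorm0.
  have := hd (s - t0); rewrite /ball /= sub0r opprB subrKC; apply => //.
  by rewrite subr_eq0.
have w1 : (wave T 1 (t - t0) - 1 : R[i]) != 0.
  rewrite subr_eq0; apply: wave1_neq1 => //; rewrite normr_gt0 subr_eq0 neq /=.
  by rewrite ltr_norml; apply/andP; split; lra.
have wc : (wave T 1 (s - t0) - 1 : R[i]^o) @[s --> t] --> (wave T 1 (t - t0) - 1 : R[i]^o).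
  have sc : s - t0 @[s --> t] --> t - t0 by apply: cvgB => //; exact: cvg_cst.
  have wwc : wave T 1 (s - t0) @[s --> t] --> wave T 1 (t - t0).
    apply: (@cvg_comp _ _ _ (fun s => s - t0) (wave T 1) _ _ _ sc).
    exact: wave_continuous.
  exact: (cvgB wwc (cvg_cst (1 : R[i]^o))).
rewrite /continuous_at {2}/wave_quotient (negbTE neq).
apply: cvg_trans (cvgZ (cvgV w1 wc) (cvgB (fc t) (cvg_cst (f t0)))).
apply: near_eq_cvg; have tt0 : 0 < `|t - t0| by rewrite normr_gt0 subr_eq0.
apply/nbhs_ballP; exists `|t - t0| => //= s; rewrite /ball /= => st.
rewrite /wave_quotient; case: eqP => // sE; move: st; by rewrite sE ltxx.
Qed.

Lemma eq_fourier f h n : (forall t, t \in `[0, T] -> f t = h t) ->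
  fourier T f n = fourier T h n.
Proof.
move=> fh; rewrite /fourier /Rint.
have -> // : riemann 0 T (fun t => (wave T (- n) t : R[i]) *: f t) =
  riemann 0 T (fun t => (wave T (- n) t : R[i]) *: h t).
apply/funext => m; rewrite /riemann big_nat [RHS]big_nat.
apply: eq_bigr => k /andP[_ /ltnW k2].
by rewrite fh// node_itv// ltW.
Qed.

(** Chernoff's argument: dividing [f - f t0] by the first wave shifted to vanish
    at [t0] turns the partial sums into a telescoping sum of Fourier
    coefficients of a continuous function, which tend to zero. *)
Lemma fourier_inversion_interior f t0 y : 0 < t0 < T -> is_tderiv f t0 y ->
  continuous f ->
  zpsum (fun n => (wave T n t0 : R[i]) *: fourier T f n) N @[N --> \oo] --> f t0.
Proof.
move=> t0T fy fc; set h := wave_quotient f y t0.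
have hc : {within `[0, T], continuous h} by exact: wave_quotient_continuous.
have fw : {within `[0, T], continuous f} by exact: continuous_subspaceT.
have cw : {within `[0, T], continuous (fun _ : R => f t0)}.
  by apply: continuous_subspaceT => t; exact: cvg_cst.
pose b n := (wave T n t0 : R[i]) *: fourier T h n.
have coef n : (wave T n t0 : R[i]) *: fourier T f n =
    b (n - 1) - b n + (if n == 0 then f t0 else 0).
  have -> : fourier T f n = fourier T (fun t => f t - f t0) n +
      (if n == 0 then f t0 else 0).
    by rewrite fourierB// fourier_cst// subrK.
  have -> : fourier T (fun t => f t - f t0) n =
      fourier T (fun t => (wave T (- 1) t0 : R[i]) *: ((wave T 1 t : R[i]) *: h t)
                          - h t) n.
    apply: eq_fourier => t; rewrite in_itv /= => /andP[ta tb].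
    rewrite (wave_quotientK f y); last first.
      by move/andP: t0T => [? ?]; rewrite ltr_norml; apply/andP; split; lra.
    rewrite scalerBl scale1r scalerA -/h; congr (_ *: _ - _).
    by rewrite wave_shift mulrC /wave freqN mulrN mulNr.
  rewrite fourierB//; last first.
    by apply: within_scale_cst; exact: within_wave_scale.
  rewrite fourierZ//; last exact: within_wave_scale.
  rewrite fourier_modulate scalerDr scalerBr scalerA -[in LHS]waveD.
  by congr (_ + _); case: eqP => [->|_]; rewrite ?wave0 ?scale1r ?scaler0.
(* the partial sum of order N + 1 runs over the integers from - N - 1 to N *)
have tele N : zpsum (fun n => (wave T n t0 : R[i]) *: fourier T f n) N.+1 =
    f t0 + b (Negz N.+1) - b (Posz N).
  elim: N => [|N IHN].
    rewrite zpsumS /zpsum big_nil add0r !coef eqxx addr0 (_ : Posz 0 - 1 = Negz 0)//.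
    rewrite (_ : Negz 0 - 1 = Negz 1)// !addrA.
    by rewrite [LHS](ACl (3*4*2*(1*5)))/= subrr addr0.
  rewrite zpsumS IHN !coef /= !addr0.
  rewrite (_ : Posz N.+1 - 1 = N); last by rewrite -addn1 PoszD addrK.
  rewrite (_ : Negz N.+1 - 1 = Negz N.+2); last first.
    by rewrite !NegzE -opprD -PoszD addn1.
  by rewrite !addrA [LHS](ACl (1*6*5*(2*7)*(3*4)))/= subrr addNr !addr0.
apply/cvg_rnormP => e e0; have e30 : 0 < e / 3 by rewrite divr_gt0.
have [N hN] := riemann_lebesgue hc e30.
exists N.+1 => // -[//|M] /= NM; rewrite tele addrAC [f t0 + _]addrC addrK.
have bN n : (N <= `|n|)%N -> rnorm (b n) <= e / 3 by rewrite rnorm_waveZ; exact: hN.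
apply: le_lt_trans (ler_rnormB _ _) _.
have h1 := bN (Negz M.+1) (leq_trans (ltnW NM) (leqnSn _)).
have h2 := bN (Posz M) NM.
lra.
Qed.

End FourierInversion.

Section FullInversion.
Context {R : realType} {V : completeNormedModType R[i]} (T : R).
Hypothesis T0 : 0 < T.

(** Continuity extends the vanishing from the open period to its left end, and
    periodicity to the line. *)
Lemma periodic_eq0 (d : R -> V) : continuous d -> periodic d T ->
  (forall t, 0 < t < T -> d t = 0) -> forall t, d t = 0.
Proof.
move=> dc dT d0.
have d00 : d 0 = 0.
  apply: rnorm0_eq0; apply/eqP; rewrite eq_le rnorm_ge0 andbT.
  apply/ler_addgt0Pr => e e0; rewrite add0r.
  have /cvg_rnormP/(_ e e0)/nbhs_ballP[r /= r0 hr] := dc 0.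
  (* a point of the open period within the continuity radius r of 0 *)
  pose s := Num.min (r / 2) (T / 2).
  have s0 : 0 < s by rewrite lt_min !divr_gt0.
  have sr : s < r.
    by rewrite gt_min; apply/orP; left; rewrite ltr_pdivrMr// ltr_pMr// ltr1n.
  have sT : s < T.
    by rewrite gt_min; apply/orP; right; rewrite ltr_pdivrMr// ltr_pMr// ltr1n.
  have := hr s; rewrite /ball /= sub0r normrN gtr0_norm// => /(_ sr).
  by rewrite d0 ?s0// sub0r rnormN => /ltW.
have d0T t : 0 <= t < T -> d t = 0.
  by rewrite le_eqVlt => /andP[/orP[/eqP <-//|t0 tT]]; rewrite d0 ?t0.
have shift n t : d (t + T *+ n) = d t by exact: periodicn.
move=> t; wlog t0 : t / 0 <= t => [H|].
  rewrite -(shift (Num.truncn (`|t| / T)).+1); apply: H.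
  have : `|t| < T *+ (Num.truncn (`|t| / T)).+1.
    by rewrite -mulr_natr mulrC -ltr_pdivrMr// truncnS_gt.
  by have := lerNnormlW (lexx `|t|); lra.
have tT0 : 0 <= t / T by rewrite divr_ge0 ?(ltW T0).
set n := Num.truncn (t / T).
rewrite -(subrK (T *+ n) t) shift; apply: d0T.
have /andP[h1 h2] := truncn_itv tT0; rewrite -/n in h1 h2.
move: h1 h2; rewrite ler_pdivlMr// ltr_pdivrMr// ![_ * T]mulrC !mulr_natr mulrS.
by move=> h1 h2; apply/andP; split; lra.
Qed.

Lemma wave_series_periodic (y : int -> V) : periodic (wave_series T y) T.
Proof.
move=> t; rewrite /wave_series; congr zsum; apply/funext => n.
by rewrite wave_periodic.
Qed.

(** The sum of the Fourier series is differentiable and periodic, like f, so the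
    two agree everywhere once they agree in the interior of one period. *)
Lemma fourier_inversion (f : R -> V) : smooth_periodic T f ->
  forall t, zpsum (fun n => (wave T n t : R[i]) *: fourier T f n) N
    @[N --> \oo] --> f t.
Proof.
move=> fs; have [K K0 hK] := fourier_decay T0 4 fs.
have cvgF t : zpsum (fun n => (wave T n t : R[i]) *: fourier T f n) N
    @[N --> \oo] --> wave_series T (fourier T f) t.
  apply: (zsum_cvg T0 (K := K)); apply: (le_decays (p := 2) hK) => n.
  by rewrite rnorm_waveZ ler_peMr ?rnorm_ge0// exprn_ege1// lerDl.
have [g [g0 gd gT gc]] := smooth_periodicP fs.
suff d0 t : wave_series T (fourier T f) t - f t = 0.
  by move=> t; have /subr0_eq <- := d0 t.
apply: (@periodic_eq0 (fun t => wave_series T (fourier T f) t - f t)) => {t}.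
- move=> t; apply: cvgB; last by rewrite -g0; exact: gc.
  exact: tderiv_continuous (tderiv_wave_series T0 hK).
- by move=> t; rewrite wave_series_periodic -g0 gT.
- move=> t tT; apply/eqP; rewrite subr_eq0; apply/eqP.
  apply: cvg_unique (cvgF t) _ => //.
  apply: (fourier_inversion_interior T0 tT) => //.
    by rewrite -g0; exact: gd.
  by rewrite -g0; exact: gc.
Qed.

End FullInversion.

(** * Bounded operators, generators and resolvents *)

Section BoundedOperators.
Context {R : realType} {H : normedModType R[i]}.
Implicit Types (L : H -> H) (x y : H) (c : R[i]) (M : R).

Lemma lin0 L : linear L -> L 0 = 0.
Proof.
move=> lL; have := lL 1 0 0; rewrite !scale1r addr0 => h.
by apply: (addrI (L 0)); rewrite addr0 -h.
Qed.

Lemma linD L x y : linear L -> L (x + y) = L x + L y.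
Proof. by move=> lL; have := lL 1 x y; rewrite !scale1r. Qed.

Lemma linZ L c x : linear L -> L (c *: x) = c *: L x.
Proof. by move=> lL; have := lL c x 0; rewrite (lin0 lL) !addr0. Qed.

Lemma linB L x y : linear L -> L (x - y) = L x - L y.
Proof. by move=> lL; rewrite linD// -scaleN1r linZ// scaleN1r. Qed.

Lemma opnorm_le L M : linear L -> (opnorm L <= M%:E)%E ->
  forall x, rnorm (L x) <= M * rnorm x.
Proof.
move=> lL LM x; have [->|x0] := eqVneq x 0; first by rewrite lin0// rnorm0 mulr0.
have nx : 0 < rnorm x.
  by rewrite lt_neqAle rnorm_ge0 andbT eq_sym; apply: contra_neq x0; exact: rnorm0_eq0.
set z := ((rnorm x)^-1)%:C *: x.
have z1 : rnorm z = 1 by rewrite rnormZr gtr0_norm ?invr_gt0// mulVf// gt_eqF.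
have : ((rnorm (L z))%:E <= M%:E)%E.
  by apply: le_trans LM; apply: ereal_sup_ubound; exists z => //=; rewrite z1.
rewrite lee_fin linZ// rnormZr gtr0_norm ?invr_gt0// mulrC.
by rewrite ler_pdivrMr.
Qed.

Lemma le_opnorm L M : (forall x, rnorm (L x) <= M * rnorm x) -> 0 <= M ->
  (opnorm L <= M%:E)%E.
Proof.
move=> LM M0; apply: ge_ereal_sup => _ [x /= x1 <-]; rewrite lee_fin.
by apply: le_trans (LM x) _; rewrite -[leRHS]mulr1 ler_wpM2l.
Qed.

Lemma opnorm_bounded L : linear L -> (opnorm L < +oo)%E ->
  exists2 M, 0 <= M & forall x, rnorm (L x) <= M * rnorm x.
Proof.
move=> lL; have := @opnorm_le L; case: (opnorm L) => // [r|] h _.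
  exists `|r| => // x; apply: le_trans (h r lL _ x) _; first exact: lexx.
  by rewrite ler_wpM2r ?rnorm_ge0// ler_norm.
by exists 0 => // x; apply: h => //; rewrite leNye.
Qed.

End BoundedOperators.

Section Generator.
Context {R : realType} {H : completeNormedModType R[i]}.
Context (A : operator H) (S : R -> H -> H).
Hypotheses (Ssg : C0_semigroup S) (AS : generates A S).
Implicit Types (x y : H) (c : R[i]) (lam : R[i]).

Lemma generator_cvg x l :
  (h^-1)%:C *: (S h x - x) @[h --> 0^'+] --> l -> dom A x /\ A x = l.
Proof.
move=> xl; have [dA hA] := AS; have xA : dom A x by rewrite dA; apply/cvg_ex; exists l.
by split=> //; apply: cvg_unique (hA _ xA) xl.
Qed.

Lemma generator_linear c x y : dom A x -> dom A y ->
  dom A (c *: x + y) /\ A (c *: x + y) = c *: A x + A y.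
Proof.
move=> xA yA; apply: generator_cvg; have [_ hA] := AS.
have X : (c *: ((h^-1)%:C *: (S h x - x)) + (h^-1)%:C *: (S h y - y))
    @[h --> 0^'+] --> c *: A x + A y.
  by apply: cvgD; [apply: cvgZ; [exact: cvg_cst|exact: hA]|exact: hA].
apply: cvg_trans X; apply: near_eq_cvg; near=> h; have h0 : 0 <= h by apply: ltW.
rewrite /= (semigroup_linear Ssg h0) scalerA mulrC -scalerA -scalerDr; congr (_ *: _).
by rewrite scalerBr opprD addrACA.
Unshelve. all: by end_near. Qed.

Lemma generator0 : dom A 0 /\ A 0 = 0.
Proof.
apply: generator_cvg; have X : (0 : H) @[_ --> (0 : R)^'+] --> (0 : H) by exact: cvg_cst.
apply: cvg_trans X; apply: near_eq_cvg.
near=> h; have h0 : 0 <= h by apply: ltW.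
by rewrite (lin0 (semigroup_linear Ssg h0)) subrr scaler0.
Unshelve. all: by end_near. Qed.

Lemma generatorD x y : dom A x -> dom A y ->
  dom A (x + y) /\ A (x + y) = A x + A y.
Proof. by move=> xA yA; have := generator_linear 1 xA yA; rewrite !scale1r. Qed.

Lemma generatorZ c x : dom A x -> dom A (c *: x) /\ A (c *: x) = c *: A x.
Proof.
have [dA0 A0] := generator0; move=> xA.
by have := generator_linear c xA dA0; rewrite A0 !addr0.
Qed.

Lemma generatorB x y : dom A x -> dom A y ->
  dom A (x - y) /\ A (x - y) = A x - A y.
Proof.
move=> xA yA; have [yA' Ay] := generatorZ (-1) yA.
by have := generatorD xA yA'; rewrite Ay !scaleN1r.
Qed.

Lemma resolventP lam y : resolvent_set A lam ->
  dom A (resolvent A lam y) /\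
  lam *: resolvent A lam y - A (resolvent A lam y) = y.
Proof.
move=> [/(_ y)[x [hx _]] _].
by have := @getPex H [set x | dom A x /\ lam *: x - A x = y] (ex_intro _ x hx).
Qed.

Lemma resolvent_unique lam x y : resolvent_set A lam -> dom A x ->
  lam *: x - A x = y -> x = resolvent A lam y.
Proof.
move=> rl xA xy; have [/(_ y)[z [_ hz]] _] := rl.
by rewrite -(hz x)//; apply: hz; exact: resolventP.
Qed.

Lemma resolvent_linear lam : resolvent_set A lam -> linear (resolvent A lam).
Proof.
move=> rl c x y; apply/esym/resolvent_unique => //;
  have [xA xE] := resolventP x rl; have [yA yE] := resolventP y rl;
  have [dA lA] := generator_linear c xA yA => //.
rewrite lA; set u := resolvent A lam x; set v := resolvent A lam y.
transitivity (c *: (lam *: u - A u) + (lam *: v - A v)); last by rewrite xE yE.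
by rewrite scalerDr scalerBr opprD addrACA !scalerA [c * lam]mulrC.
Qed.

(** With R the resolvent at lam, x n = R (lam x n - A (x n)); R is continuous and
    maps into the domain. *)
Lemma generator_closed lam (x : nat -> H) (l y : H) : resolvent_set A lam ->
  (forall n, dom A (x n)) -> x n @[n --> \oo] --> l ->
  A (x n) @[n --> \oo] --> y -> dom A l /\ A l = y.
Proof.
move=> rl xA xl Ay; have rL := resolvent_linear rl.
have [M M0 hM] := opnorm_bounded rL rl.2.
set z := lam *: l - y.
have zc : (lam *: x n - A (x n)) @[n --> \oo] --> z.
  by apply: cvgB Ay; apply: cvgZ xl; exact: cvg_cst.
have M1 : 0 < M + 1 by rewrite ltr_pwDr.
have Rz : x n @[n --> \oo] --> resolvent A lam z.
  apply/cvg_rnormP => e e0.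
  move/cvg_rnormP: zc => /(_ _ (divr_gt0 e0 M1)); apply: filterS => n.
  rewrite ltr_pdivlMr// => h.
  have := resolvent_unique rl (xA n) erefl; move: h; set w := _ - A (x n) => h ->.
  rewrite -linB//; apply: le_lt_trans (hM _) _.
  by apply: le_lt_trans h; rewrite mulrC ler_wpM2l ?rnorm_ge0// lerDl.
have lE : l = resolvent A lam z by exact: cvg_unique xl Rz.
have [dA] := resolventP z rl; rewrite -lE => hz; split; first by rewrite lE.
by move: hz; rewrite /z => /addrI/oppr_inj.
Qed.

End Generator.

(** * Duhamel's formula *)

Section Duhamel.
Context {R : realType} {H : completeNormedModType R[i]}.
Context (A : operator H) (S : R -> H -> H).
Hypotheses (Ssg : C0_semigroup S) (AS : generates A S).
Hypothesis Sbd : uniformly_bounded S.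
Implicit Types (x y : H) (t s e : R) (u du f v : R -> H).

Lemma semigroup_bound : exists2 M, 0 <= M &
  forall t x, 0 <= t -> rnorm (S t x) <= M * rnorm x.
Proof.
have [M hM] := Sbd; exists `|M| => // t x t0.
apply: le_trans (opnorm_le (semigroup_linear Ssg t0) (hM t t0) x) _.
by rewrite ler_wpM2r ?rnorm_ge0// ler_norm.
Qed.

(** S t - S s = S s (S (t - s) - I), so bounded semigroups turn continuity at 0
    into continuity at every time. *)
Lemma semigroup_diff M s t x : (forall t x, 0 <= t -> rnorm (S t x) <= M * rnorm x) ->
  0 <= s -> s <= t -> rnorm (S t x - S s x) <= M * rnorm (S (t - s) x - x).
Proof.
move=> hM s0 st; rewrite -{1}(subrKC s t) (semigroupD Ssg)//; last by rewrite subr_ge0.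
by rewrite -(linB _ _ (semigroup_linear Ssg s0)) hM.
Qed.

(** Dividing by M + 1 rather than M allows M = 0. *)
Lemma ltr_scaled_halves (M e p q : R) : 0 <= M -> 0 <= p -> 0 <= q ->
  p < e / 2 / (M + 1) -> q < e / 2 / (M + 1) -> M * p + M * q < e.
Proof.
move=> M0 p0 q0 hp hq; have M1 : 0 < M + 1 by rewrite ltr_pwDr.
rewrite -mulrDr; apply: (@le_lt_trans _ _ ((M + 1) * (p + q))).
  by rewrite ler_wpM2r ?addr_ge0// lerDl.
rewrite mulrC -ltr_pdivlMr// [e in _ < e / _]splitr mulrDl.
exact: ltrD.
Qed.

Lemma orbit_continuous v t : continuous v ->
  {within `[0, t], continuous (fun s => S (t - s) (v s))}.
Proof.
move=> vc; have [M M0 hM] := semigroup_bound.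
apply/subspace_continuousP => s0; rewrite /= in_itv /= => /andP[s00 s0t].
apply/cvg_rnormP => e e0; rewrite near_withinE.
have M1 : 0 < M + 1 by rewrite ltr_pwDr.
have e1 : 0 < e / 2 / (M + 1) by rewrite !divr_gt0.
have /cvg_rnormP/(_ _ e1) h1 := vc s0.
have /cvg_rnormP/(_ _ e1) := @semigroup_cvg0 _ _ _ Ssg (v s0).
rewrite near_withinE => /nbhs_ballP[d /= d0 hd].
have h2 : \forall s \near s0, rnorm (S `|s - s0| (v s0) - v s0) < e / 2 / (M + 1).
  apply/nbhs_ballP; exists d => //= s; rewrite /ball /= distrC => sd.
  have [->|neq] := eqVneq s s0.
    by rewrite subrr normr0 (semigroup0 Ssg) subrr rnorm0.
  by apply: hd; rewrite /ball /= ?sub0r ?normrN ?normr_id// normr_gt0 subr_eq0.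
near=> s; rewrite /= in_itv /= => /andP[s1 st].
have ts : 0 <= t - s by rewrite subr_ge0.
have ts0 : 0 <= t - s0 by rewrite subr_ge0.
have hv : rnorm (v s - v s0) < e / 2 / (M + 1) by near: s.
have hS : rnorm (S `|s - s0| (v s0) - v s0) < e / 2 / (M + 1) by near: s.
have hD : rnorm (S (t - s) (v s0) - S (t - s0) (v s0)) <=
    M * rnorm (S `|s - s0| (v s0) - v s0).
  have [ss|/ltW ss] := leP s s0.
    apply: le_trans (semigroup_diff _ hM ts0 _) _; first by rewrite lerD2l lerN2.
    by rewrite ler0_norm ?subr_le0// (_ : t - s - (t - s0) = - (s - s0))//; ring.
  rewrite rnorm_distC; apply: le_trans (semigroup_diff _ hM ts _) _; first by rewrite lerD2l lerN2.
  by rewrite ger0_norm ?subr_ge0// (_ : t - s0 - (t - s) = s - s0)//; ring.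
rewrite -(subrKA (S (t - s) (v s0))) -(linB _ _ (semigroup_linear Ssg ts)).
apply: le_lt_trans (ler_rnormD _ _) _.
apply: le_lt_trans (lerD (hM _ _ ts) hD) _; apply: ltr_scaled_halves => //; exact: rnorm_ge0.
Unshelve. all: by end_near. Qed.

(** For h > 0 the increment from s to s + h equals S (t - s - h) applied to
    u (s + h) - S h (u s). Dividing by h, the argument tends to u'(s) - A u(s),
    and the uniformly bounded operators in front converge strongly. *)
Lemma duhamel_right_deriv u du t s : 0 <= s < t -> is_tderiv u s (du s) ->
  dom A (u s) ->
  right_deriv (fun r => S (t - r) (u r)) s (S (t - s) (du s - A (u s))).
Proof.
move=> /andP[s0 st] us uA; have [M M0 hM] := semigroup_bound.
have M1 : 0 < M + 1 by rewrite ltr_pwDr.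
set y := du s - A (u s).
pose q h := (h^-1)%:C *: (u (s + h) - u s) - (h^-1)%:C *: (S h (u s) - u s).
have qy : q h @[h --> 0^'+] --> y.
  by apply: cvgB; [exact: tderiv_right us|exact: AS.2].
apply/cvg_rnormP => e e0.
have e1 : 0 < e / 2 / (M + 1) by rewrite !divr_gt0.
have ts0 : 0 < t - s by rewrite subr_gt0.
near=> h.
have h0 : 0 < h by [].
have hts : h <= t - s by near: h; exact: nbhs_right_le.
have hS : rnorm (S h y - y) < e / 2 / (M + 1).
  by near: h; move/cvg_rnormP: (@semigroup_cvg0 _ _ _ Ssg y) => /(_ _ e1).
have hq : rnorm (q h - y) < e / 2 / (M + 1).
  by near: h; move/cvg_rnormP: qy => /(_ _ e1).
set r := t - (s + h); have r0 : 0 <= r by rewrite /r; lra.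
have lr := semigroup_linear Ssg r0.
have tsE : t - s = r + h by rewrite /r; ring.
have Sts z : S (t - s) z = S r (S h z) by rewrite tsE (semigroupD Ssg)// ltW.
have -> : (h^-1)%:C *: (S r (u (s + h)) - S (t - s) (u s)) - S (t - s) y =
    S r (q h - y) - S r (S h y - y).
  rewrite !Sts -linB// -linZ// -!linB//; congr (S r _).
  have cancel (a b c : H) : a - b - (c - b) = a - c by rewrite opprB addrA subrK.
  by rewrite cancel /q -scalerBr cancel.
apply: le_lt_trans (ler_rnormB _ _) _.
apply: le_lt_trans (lerD (hM _ _ r0) (hM _ _ r0)) _.
apply: ltr_scaled_halves => //; exact: rnorm_ge0.
Unshelve. all: by end_near. Qed.

Section ClassicalSolutions.
Variables (u du f : R -> H).
Hypotheses (uD : forall t, is_tderiv u t (du t)) (fc : continuous f).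
Hypothesis uA : forall t, dom A (u t) /\ du t = A (u t) + f t.

(** For a solution, the right derivative of S (t - s) (u s) in s is
    S (t - s) (f s); integrate from 0 to t. *)
Lemma duhamel t : 0 <= t ->
  riemann 0 t (fun s => S (t - s) (f s)) n @[n --> \oo] --> u t - S t (u 0).
Proof.
move=> t0; have uc : continuous u by move=> s; exact: tderiv_continuous (@uD s).
have := @riemann_ftc _ _ 0 t (fun s => S (t - s) (u s)) (fun s => S (t - s) (f s))
  t0 (orbit_continuous uc) (orbit_continuous fc).
rewrite subrr (semigroup0 Ssg) subr0; apply => s st.
have [dA duE] := uA s; have := duhamel_right_deriv st (@uD s) dA.
by rewrite duE addrAC subrr add0r.
Qed.

Lemma classical_mild : mild_solution S f u.
Proof.
exists (u 0) => t t0; exists (u t - S t (u 0)); last by rewrite addrC subrK.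
by apply: riemann_bochner => //; [exact: orbit_continuous|exact: duhamel].
Qed.

End ClassicalSolutions.

(** A periodic solution of the homogeneous equation is an orbit returning to
    its start, which strong stability sends to zero. *)
Lemma periodic_homogeneous_eq0 u T : 0 < T -> strongly_stable S ->
  periodic u T -> (forall t, is_tderiv u t (A (u t))) ->
  (forall t, dom A (u t)) -> forall t, u t = 0.
Proof.
move=> T0 Sst uT uD uA.
have orb t : 0 <= t -> u t = S t (u 0).
  move=> t0; apply/eqP; rewrite -subr_eq0; apply/eqP.
  have c0 : continuous (fun _ : R => 0 : H) by move=> s; exact: cvg_cst.
  have uE s : dom A (u s) /\ A (u s) = A (u s) + 0 by rewrite addr0.
  have D := duhamel uD c0 uE t0.
  apply: (cvg_unique _ D) => //.
  have -> : riemann 0 t (fun s => S (t - s) 0) = fun=> 0.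
    apply/funext => n; rewrite /riemann big_nat big1// => k /andP[_ /ltnW k2].
    rewrite (@lin0 _ _ (S _)) ?scaler0//; apply: semigroup_linear => //.
    by have := node_itv t0 k2; rewrite in_itv /= subr_ge0 => /andP[].
  exact: cvg_cst.
have per n t : u (t + T *+ n) = u t by exact: periodicn.
have u00 : u 0 = 0.
  apply: rnorm0_eq0; apply/eqP; rewrite eq_le rnorm_ge0 andbT.
  apply/ler_addgt0Pr => e e0; rewrite add0r.
  have /cvg_rnormP/(_ _ e0)[B [_ hB]] := Sst (u 0).
  pose n := (Num.truncn (`|B| / T)).+1.
  have nB : B < T *+ n.
    apply: le_lt_trans (ler_norm B) _.
    by rewrite -mulr_natr mulrC -ltr_pdivrMr// truncnS_gt.
  have := hB _ nB; rewrite /= subr0 -orb; last by rewrite mulrn_wge0 ?(ltW T0).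
  by have := per n 0; rewrite add0r => -> /ltW.
have pos t : 0 <= t -> u t = 0.
  by move=> t0; rewrite orb// u00 (lin0 (semigroup_linear Ssg t0)).
move=> t; rewrite -(per (Num.truncn (`|t| / T)).+1); apply: pos.
have : `|t| < T *+ (Num.truncn (`|t| / T)).+1.
  by rewrite -mulr_natr mulrC -ltr_pdivrMr// truncnS_gt.
by have := lerNnormlW (lexx `|t|); lra.
Qed.

End Duhamel.

(** * The periodic problem *)

Section PeriodicProblem.
Context {R : realType} {H : completeNormedModType R[i]}.
Context (A : operator H) (S : R -> H -> H) (T : R).
Hypotheses (Ssg : C0_semigroup S) (AS : generates A S).
Hypotheses (Sbd : uniformly_bounded S) (Sst : strongly_stable S).
Hypothesis T0 : 0 < T.
Hypothesis rho : forall n : int, resolvent_set A (ifreq T n).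
Implicit Types (f u w : R -> H) (n : int) (x : H).

Lemma generator_zpsum (a : int -> H) N : (forall n, dom A (a n)) ->
  dom A (zpsum a N) /\ A (zpsum a N) = zpsum (fun n => A (a n)) N.
Proof.
move=> aA; elim: N => [|N [IHd IHA]].
  by rewrite /zpsum !big_nil; exact: (generator0 Ssg AS).
have [d1 A1] := generatorD Ssg AS (aA N) (aA (Negz N)).
have [d2 A2] := generatorD Ssg AS IHd d1.
by rewrite !zpsumS; split => //; rewrite A2 A1 IHA.
Qed.

Lemma classical_solution_unique f u w : periodic_classical_solution A T f u ->
  periodic_classical_solution A T f w -> w = u.
Proof.
move=> [uT [du [_ uD uA]]] [wT [dw [_ wD wA]]].
apply/funext => t; apply/subr0_eq.
apply: (periodic_homogeneous_eq0 Ssg AS Sbd (u := fun t => w t - u t) T0 Sst).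
- by move=> s; rewrite wT uT.
- move=> s; have [u1 u2] := uA s; have [w1 w2] := wA s.
  have [_ ->] := generatorB Ssg AS w1 u1.
  have -> : A (w s) - A (u s) = dw s - du s by rewrite u2 w2 opprD addrACA subrr addr0.
  exact: (tderivB (wD s) (uD s)).
- by move=> s; have [+ _] := generatorB Ssg AS (wA s).1 (uA s).1.
Qed.

Lemma wave_solution n x : periodic_classical_solution A T
  (fun t => (wave T n t : R[i]) *: x)
  (fun t => (wave T n t : R[i]) *: resolvent A (ifreq T n) x).
Proof.
have [dR hR] := resolventP x (rho n); set z := resolvent _ _ _ in dR hR *.
split; first by move=> t; rewrite wave_periodic.
exists (fun t => (wave T n t : R[i]) *: (ifreq T n *: z)); split.
- move=> t; apply: tderiv_continuous.
  exact: (tderiv_waveZ (T := T) (n := n) (t := t) (x := ifreq T n *: z)).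
- by move=> t; exact: tderiv_waveZ.
- move=> t; have [d1 ->] := generatorZ Ssg AS (wave T n t) dR; split => //.
  by rewrite -scalerDr -[in RHS]hR subrKC.
Qed.

(** Superposing the solutions for the single waves, the Fourier coefficients
    beat the polynomial growth of the resolvents in every order. *)
Lemma smooth_periodic_solution f : (exists (m : nat) (C : R), 0 < C /\
    forall n, (opnorm (resolvent A (ifreq T n)) <=
      (C * (1 + `|freq T n|) ^+ m)%R%:E)%E) -> smooth_periodic T f ->
  exists2 u, periodic_classical_solution A T f u & smooth_periodic T u.
Proof.
move=> [m [C [C0 hC]]] fs.
pose y n := resolvent A (ifreq T n) (fourier T f n).
have yA n : dom A (y n) /\ ifreq T n *: y n - A (y n) = fourier T f n.
  exact: resolventP.
have w1 n : 0 <= 1 + `|freq T n| by rewrite addr_ge0.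
have yK k : exists K, forall n,
    rnorm (ifreq T n ^+ k *: y n) * (1 + `|freq T n|) ^+ 4 <= K.
  (* k for the derivative, m for the resolvent, 4 for termwise differentiation *)
  have [K K0 hK] := fourier_decay T0 (k + m + 4) fs.
  exists (C * K) => n; rewrite rnorm_ifreqZ.
  have h1 : rnorm (y n) <= C * (1 + `|freq T n|) ^+ m * rnorm (fourier T f n).
    exact: opnorm_le (resolvent_linear Ssg AS (rho n)) (hC n) _.
  have h2 : `|freq T n| ^+ k <= (1 + `|freq T n|) ^+ k.
    by apply: lerXn2r; rewrite ?nnegrE// lerDr.
  apply: le_trans (ler_wpM2l (ltW C0) (hK n)).
  apply: (@le_trans _ _ ((1 + `|freq T n|) ^+ k *
    (C * (1 + `|freq T n|) ^+ m * rnorm (fourier T f n)) * (1 + `|freq T n|) ^+ 4)).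
    rewrite ler_wpM2r ?exprn_ge0//.
    apply: ler_pM h2 h1; rewrite ?exprn_ge0 ?rnorm_ge0//.
  by rewrite !exprD le_eqVlt; apply/orP; left; apply/eqP; ring.
pose g k := wave_series T (fun n => ifreq T n ^+ k *: y n).
have gD k t : is_tderiv (g k) t (g k.+1 t).
  have [K hK] := yK k; rewrite /g (_ : (fun n => ifreq T n ^+ k.+1 *: y n) =
    (fun n => ifreq T n *: (ifreq T n ^+ k *: y n))).
    exact: tderiv_wave_series hK.
  by apply/funext => n; rewrite scalerA exprS.
have gT k : periodic (g k) T by exact: wave_series_periodic.
have cvg_g k t : zpsum (fun n => (wave T n t : R[i]) *: (ifreq T n ^+ k *: y n)) N
    @[N --> \oo] --> g k t.
  have [K hK] := yK k; apply: (zsum_cvg T0 (K := K)).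
  apply: (le_decays (p := 2) hK) => n.
  by rewrite rnorm_waveZ ler_peMr ?rnorm_ge0// exprn_ege1// lerDl.
exists (g 0%N); last by split => //; exists g.
split => //; exists (g 1%N); split => //.
  by move=> t; exact: tderiv_continuous (gD 1%N t).
move=> t; pose x N := zpsum (fun n => (wave T n t : R[i]) *: y n) N.
have wA n : dom A ((wave T n t : R[i]) *: y n) /\ A ((wave T n t : R[i]) *: y n) =
    (wave T n t : R[i]) *: (ifreq T n ^+ 1 *: y n) - (wave T n t : R[i]) *: fourier T f n.
  have [d1 ->] := generatorZ Ssg AS (wave T n t) (yA n).1; split => //.
  by rewrite -scalerBr -(yA n).2 expr1 opprB subrKC.
have xA N := generator_zpsum N (fun n => (wA n).1).
have xg : x N @[N --> \oo] --> g 0%N t.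
  have := cvg_g 0%N t; rewrite (_ : zpsum _ = x)//.
  by apply/funext => N; congr zpsum; apply/funext => n; rewrite expr0 scale1r.
have Ag : A (x N) @[N --> \oo] --> g 1%N t - f t.
  rewrite (_ : (fun N => A (x N)) = fun N =>
    zpsum (fun n => (wave T n t : R[i]) *: (ifreq T n ^+ 1 *: y n)) N -
    zpsum (fun n => (wave T n t : R[i]) *: fourier T f n) N).
    by apply: cvgB; [exact: cvg_g|exact: fourier_inversion].
  apply/funext => N; rewrite (xA N).2 -sumrB; apply: eq_bigr => j _.
  by rewrite !(wA _).2 opprD addrACA.
have [dg ->] := generator_closed Ssg AS (rho 0) (fun N => (xA N).1) xg Ag.
by split => //; rewrite subrK.
Qed.

End PeriodicProblem.

(** * Sobolev norms of single waves *)

Section WaveNorms.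
Context {R : realType} {H : completeNormedModType R[i]} (T : R).
Hypothesis T0 : 0 < T.
Implicit Types (n : int) (x : H) (k j : nat).

Lemma wave_scale_continuous n x : continuous (fun t => (wave T n t : R[i]) *: x).
Proof.
by move=> t; exact: tderiv_continuous (tderiv_waveZ (T := T) (n := n) (t := t) (x := x)).
Qed.

(** The norm of a wave is constant in time. *)
Lemma L2norm_wave n x :
  L2norm T (fun t => (wave T n t : R[i]) *: x) = (Num.sqrt T * rnorm x)%:E.
Proof.
rewrite /L2norm; under eq_integral do rewrite rnorm_waveZ.
rewrite integral_cst//= lebesgue_measure_itv /= lte_fin T0 sube0.
rewrite -EFinM poweR_EFin powR12_sqrt; last exact: mulr_ge0 (sqr_ge0 _) (ltW T0).
by rewrite mulrC sqrtrM ?(ltW T0)// sqrtr_sqr (ger0_norm (rnorm_ge0 x)).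
Qed.

Lemma smooth_deriv_continuous (phi dphi : R -> R[i]^o) : smooth_periodic T phi ->
  (forall t, is_tderiv phi t (dphi t)) -> continuous dphi.
Proof.
move=> /smooth_periodicP[g [g0 gd _ gc]] phiD.
rewrite (_ : dphi = g 1%N); first exact: gc.
apply/funext => t; apply: (tderiv_unique (phiD t)); rewrite -g0; exact: gd.
Qed.

(** The product of the test function and the wave is periodic, so the integral
    of its derivative is zero. *)
Lemma weak_deriv_wave n x : weak_deriv T (fun t => (wave T n t : R[i]) *: x)
  (fun t => (wave T n t : R[i]) *: (ifreq T n *: x)).
Proof.
move=> phi dphi phis phiD.
have phic : continuous phi by move=> t; exact: tderiv_continuous (phiD t).
have dphic := smooth_deriv_continuous phis phiD.
have c1 : {within `[0, T], continuous
    (fun t => (dphi t : R[i]) *: ((wave T n t : R[i]) *: x))}.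
  by apply: continuous_subspaceT => t; apply: cvgZ; [exact: dphic|exact: wave_scale_continuous].
have c2 : {within `[0, T], continuous
    (fun t => (phi t : R[i]) *: ((wave T n t : R[i]) *: (ifreq T n *: x)))}.
  by apply: continuous_subspaceT => t; apply: cvgZ; [exact: phic|exact: wave_scale_continuous].
exists (Rint 0 T (fun t => (dphi t : R[i]) *: ((wave T n t : R[i]) *: x))).
split; first by apply: riemann_bochner (Rint_cvg _ _) => //; exact: ltW.
have -> : - Rint 0 T (fun t => (dphi t : R[i]) *: ((wave T n t : R[i]) *: x)) =
    Rint 0 T (fun t => (phi t : R[i]) *: ((wave T n t : R[i]) *: (ifreq T n *: x))).
  apply/eqP; rewrite eq_sym -addr_eq0 addrC; apply/eqP.
  rewrite -RintD ?(ltW T0)//.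
  rewrite (@Rint_ftc _ _ 0 T (fun t => (phi t : R[i]) *: ((wave T n t : R[i]) *: x)))
    ?(ltW T0)//.
  - have [phiT _] := phis; rewrite wave_at0 wave_atT//.
    by have := phiT 0; rewrite add0r => ->; rewrite subrr.
  - by move=> t; apply: tderiv_scale (phiD t) _; exact: tderiv_waveZ.
  - exact: (within_continuousD c1 c2).
by apply: riemann_bochner (Rint_cvg _ _) => //; exact: ltW.
Qed.

Lemma weak_jet_wave k n x : weak_jet T k (fun t => (wave T n t : R[i]) *: x)
  (fun j t => (wave T n t : R[i]) *: (ifreq T n ^+ j *: x)).
Proof.
split=> [|j _|j _].
- by apply/funext => t; rewrite expr0 scale1r.
- split; first by move=> t; rewrite wave_periodic.
  + apply: continuous_strongly_measurable; apply: continuous_subspaceT.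
    exact: wave_scale_continuous.
  + by rewrite L2norm_wave ltry.
rewrite (_ : (fun t => _ *: (ifreq T n ^+ j.+1 *: x)) =
  (fun t => (wave T n t : R[i]) *: (ifreq T n *: (ifreq T n ^+ j *: x)))).
  exact: weak_deriv_wave.
by apply/funext => t; rewrite exprS -[in LHS](scalerA (ifreq T n)).
Qed.

(** The formal derivatives of the wave are its weak derivatives, so the infimum
    is at most the value for this jet; each of its k + 1 squares is bounded by
    that of sqrt(T) |x| (1 + |w_n|)^k, and sqrt(k + 1) by k + 1. *)
Lemma sobolev_norm_wave k n x :
  (sobolev_norm T k (fun t => (wave T n t : R[i]) *: x) <=
   (k.+1%:R * (Num.sqrt T * rnorm x * (1 + `|freq T n|) ^+ k))%:E)%E.
Proof.
apply: (@le_trans _ _ ((\sum_(j < k.+1) L2norm T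
   (fun t => (wave T n t : R[i]) *: (ifreq T n ^+ j *: x)) `^ 2) `^ 2^-1)%E).
  apply: ereal_inf_lbound.
  by exists (fun j t => (wave T n t : R[i]) *: (ifreq T n ^+ j *: x));
    [exact: weak_jet_wave|].
set B := Num.sqrt T * rnorm x * (1 + `|freq T n|) ^+ k.
have B0 : 0 <= B by rewrite !mulr_ge0 ?sqrtr_ge0 ?rnorm_ge0 ?exprn_ge0 ?addr_ge0.
have -> : (\sum_(j < k.+1) L2norm T
   (fun t => (wave T n t : R[i]) *: (ifreq T n ^+ j *: x)) `^ 2)%E =
  (\sum_(j < k.+1) (Num.sqrt T * rnorm (ifreq T n ^+ j *: x)) ^+ 2)%:E.
  rewrite -sumEFin; apply: eq_bigr => j _; rewrite L2norm_wave poweR_EFin.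
  by rewrite powR_mulrn// mulr_ge0 ?sqrtr_ge0 ?rnorm_ge0.
rewrite poweR_EFin lee_fin powR12_sqrt; last by apply: sumr_ge0 => j _; exact: sqr_ge0.
have kB0 : 0 <= k.+1%:R * B by rewrite mulr_ge0.
rewrite -(ger0_norm kB0) -sqrtr_sqr; apply: ler_wsqrtr.
rewrite exprMn; apply: (@le_trans _ _ (\sum_(j < k.+1) B ^+ 2)).
  apply: ler_sum => j _; apply: lerXn2r; rewrite ?nnegrE//.
    by rewrite mulr_ge0 ?sqrtr_ge0 ?rnorm_ge0.
  rewrite rnorm_ifreqZ /B -mulrA ler_wpM2l ?sqrtr_ge0// mulrC ler_wpM2l ?rnorm_ge0//.
  apply: (@le_trans _ _ ((1 + `|freq T n|) ^+ j)).
    by apply: lerXn2r; rewrite ?nnegrE ?addr_ge0// lerDr.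
  by apply: ler_weXn2l; rewrite ?lerDl// -ltnS.
rewrite sumr_const card_ord -[_ *+ k.+1]mulr_natl ler_wpM2r ?sqr_ge0//.
by rewrite expr2 ler_peMr// ?ler1n.
Qed.

End WaveNorms.

(** * Resonance and derivative loss *)

(** For the forcing e_n(t) x with solution e_n(t) R_n x the two norms in the
    estimate are multiples of |x| and |R_n x|, so it reads as a bound on R_n. *)
Lemma sampled_bound_of_estimate (R : realType) (H : completeNormedModType R[i])
    (A : operator H) (S : R -> H -> H) (T : R) (k : nat) (C : R) :
  C0_semigroup S -> generates A S -> uniformly_bounded S -> 0 < T -> 0 < C ->
  (forall n : int, resolvent_set A (ifreq T n)) ->
  (forall f u : R -> H, sobolev_periodic T k f ->
     periodic_mild_solution S T f u ->
     (L2norm T u <= C%:E * sobolev_norm T k f)%E) ->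
  forall n : int, (opnorm (resolvent A (ifreq T n)) <=
    (C * k.+1%:R * (1 + `|freq T n|) ^+ k)%R%:E)%E.
Proof.
move=> Ssg AS Sbd T0 C0 rho est n.
have w0 : 0 <= (1 + `|freq T n|) ^+ k by rewrite exprn_ge0// addr_ge0.
apply: le_opnorm; last by rewrite !mulr_ge0// ltW.
move=> x; have [uT [du [duc uD uA]]] := wave_solution Ssg AS T0 rho n x.
have := est (fun t => (wave T n t : R[i]) *: x)
  (fun t => (wave T n t : R[i]) *: resolvent A (ifreq T n) x).
rewrite L2norm_wave// => h.
have {h} : ((Num.sqrt T * rnorm (resolvent A (ifreq T n) x))%:E <= C%:E *
    (k.+1%:R * (Num.sqrt T * rnorm x * (1 + `|freq T n|) ^+ k))%:E)%E.
  apply: le_trans (h _ _) _.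
  - by eexists; exact: weak_jet_wave.
  - split => //; apply: classical_mild uD _ uA => //; exact: wave_scale_continuous.
  - by rewrite lee_pmul2l// ?sobolev_norm_wave// lte_fin.
have sT : 0 < Num.sqrt T by rewrite sqrtr_gt0.
rewrite -EFinM lee_fin => h; rewrite -(ler_pM2l sT); apply: le_trans h _.
by rewrite le_eqVlt; apply/orP; left; apply/eqP; ring.
Qed.

Theorem proposition3p4 (R : realType) (H : completeNormedModType R[i])
    (dot : {dot H for @conjC R[i]}) (A : operator H) (S : R -> H -> H) (T : R) :
  is_inner_product dot ->
  C0_semigroup S -> generates A S ->
  uniformly_bounded S -> strongly_stable S ->
  0 < T ->
  (forall n : int, resolvent_set A (ifreq T n)) ->
  ((exists (m : nat) (C : R), 0 < C /\
      forall n : int, (opnorm (resolvent A (ifreq T n)) <=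
        (C * (1 + `|freq T n|) ^+ m)%R%:E)%E) ->
   forall f : R -> H, smooth_periodic T f ->
     exists u : R -> H,
       [/\ periodic_classical_solution A T f u,
           forall w, periodic_classical_solution A T f w -> w = u
         & smooth_periodic T u]) /\
  ((exists f : R -> H, smooth_periodic T f /\ statically_resonant S T f) ->
   infinite_derivative_loss S T).
Proof.
move=> _ Ssg AS Sbd Sst T0 rho; split=> [bnd f fs|[f [fs res]]].
  have [u uf us] := smooth_periodic_solution Ssg AS T0 rho bnd fs.
  by exists u; split => // w; exact: (classical_solution_unique Ssg AS Sbd Sst T0 uf).
move=> m m1 [C C0 est].
have bnd := sampled_bound_of_estimate Ssg AS Sbd T0 C0 rho est.
have [|u [uT [du [duc uD uA]]] _] := smooth_periodic_solution Ssg AS T0 rho _ fs.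
  by exists m.-1, (C * m.-1.+1%:R); split; rewrite ?mulr_gt0.
apply: res; exists u; split => //; apply: classical_mild uD _ uA => //.
by have [g [<- _ _ gc]] := smooth_periodicP fs; exact: gc.
Qed.
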